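(* Let $G$ be a connected Lie group such that it contains a central torus of dimension at least $2$. Then $G$ does not admit any automorphism that acts expansively on $\mathrm{Sub}^p_G$.
   Context: A torus is a compact connected abelian Lie group; a central torus of $G$ is a torus contained in the center of $G$. Automorphisms of topological groups are group automorphisms that are also homeomorphisms. For a locally compact Hausdorff group $G$, $\mathrm{Sub}_G$ denotes the set of all closed subgroups of $G$ with the Chabauty topology, generated by the sub-basis consisting of the sets $\{H\in\mathrm{Sub}_G\mid H\cap K=\emptyset\}$, $K\subset G$ compact, and $\{H\in\mathrm{Sub}_G\mid H\cap U\neq\emptyset\}$, $U\subset G$ open. This space is compact and Hausdorff, and metrizable if $G$ is second countable (in particular for connected Lie groups). A one-parameter subgroup of $G$ is (the image of) a continuous homomorphism $\mathbb{R}\to G$ (the trivial one is allowed). $\mathrm{Sub}^p_G$ denotes the smallest closed subset of $\mathrm{Sub}_G$ containing all closed one-parameter subgroups of $G$. An automorphism $T$ of $G$ acts on $\mathrm{Sub}_G$ by the homeomorphism $H\mapsto T(H)$, which leaves $\mathrm{Sub}^p_G$ invariant. A homeomorphism $\phi$ of a metrizable space $X$ with metric $d$ is expansive if there exists $\epsilon>0$ such that for all $x\neq y$ in $X$, $\sup\{d(\phi^n(x),\phi^n(y))\mid n\in\mathbb{Z}\}>\epsilon$; for compact $X$ this does not depend on the choice of the compatible metric $d$. $T$ acts expansively on $\mathrm{Sub}^p_G$ if the induced homeomorphism $H\mapsto T(H)$ of $\mathrm{Sub}^p_G$ is expansive. *)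

(* Defs.v *)
From HB Require Import structures.
From mathcomp Require Import all_boot all_order all_algebra.
From mathcomp Require Import all_classical all_reals all_analysis.
Set Implicit Arguments.
Unset Strict Implicit.
Unset Printing Implicit Defensive.
Import Order.TTheory GRing.Theory Num.Theory.
Import numFieldNormedType.Exports.
Local Open Scope classical_set_scope.
Local Open Scope ring_scope.

HB.mixin Record isTopologicalGroup G & Group G & Topological G := {
  mulg_continuous : continuous (fun p : G * G => (p.1 * p.2)%g);
  invg_continuous : continuous (fun x : G => (x^-1)%g)
}.

#[short(type="topGroupType")]
HB.structure Definition TopologicalGroup :=
  {G of Group G & Topological G & isTopologicalGroup G}.

(* [Ck k U f]: f is C^k on the open set U.  Only the values of f on U matter.
   For V and W finite-dimensional, which is the only use made of it, this is
   the usual notion, since f is C^(k+1) on U iff it has directional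
   derivatives on U in every direction and these are C^k. *)
Fixpoint Ck (R : realType) (V W : normedModType R) (k : nat) (U : set V)
    (f : V -> W) : Prop :=
  (forall x, U x -> {for x, continuous f}) /\
  if k is k'.+1 then
    forall v, (forall x, U x -> derivable f x v) /\ Ck k' U ('D_v f)
  else True.

Definition smooth_on (R : realType) (V W : normedModType R) (U : set V)
    (f : V -> W) : Prop :=
  forall k, Ck k U f.

(* A homeomorphism of an open subset of M onto an open subset of R^n; both maps
   are total functions whose values outside the two open sets are irrelevant. *)
Record chart (R : realType) (M : topologicalType) (n : nat) := Chart {
  chart_dom : set M;
  chart_cod : set 'rV[R]_n;
  chart_fun : M -> 'rV[R]_n;
  chart_inv : 'rV[R]_n -> M;
  chart_dom_open : open chart_dom;
  chart_cod_open : open chart_cod;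
  chart_fun_cod : forall x, chart_dom x -> chart_cod (chart_fun x);
  chart_inv_dom : forall y, chart_cod y -> chart_dom (chart_inv y);
  chart_funK : forall x, chart_dom x -> chart_inv (chart_fun x) = x;
  chart_invK : forall y, chart_cod y -> chart_fun (chart_inv y) = y;
  chart_fun_continuous :
    forall x, chart_dom x -> {for x, continuous chart_fun};
  chart_inv_continuous :
    forall y, chart_cod y -> {for y, continuous chart_inv}
}.

Definition smooth_atlas (R : realType) (M : topologicalType) (n : nat)
    (A : set (chart R M n)) : Prop :=
  (forall x, exists2 a, A a & chart_dom a x) /\
  (forall a b, A a -> A b ->
     smooth_on [set u | chart_cod a u /\ chart_dom b (chart_inv a u)]
               (fun u => chart_fun b (chart_inv a u))).

Definition smooth_mulg (R : realType) (G : topGroupType) (n : nat)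
    (A : set (chart R G n)) : Prop :=
  forall a b c, A a -> A b -> A c ->
    smooth_on
      [set p : 'rV[R]_n * 'rV[R]_n |
        [/\ chart_cod a p.1, chart_cod b p.2 &
            chart_dom c (chart_inv a p.1 * chart_inv b p.2)%g]]
      (fun p => chart_fun c (chart_inv a p.1 * chart_inv b p.2)%g).

Definition smooth_invg (R : realType) (G : topGroupType) (n : nat)
    (A : set (chart R G n)) : Prop :=
  forall a b, A a -> A b ->
    smooth_on
      [set u | chart_cod a u /\ chart_dom b ((chart_inv a u)^-1)%g]
      (fun u => chart_fun b ((chart_inv a u)^-1)%g).

(* Second countability is not required: it is automatic for connected Lie
   groups. *)
Definition lie_group (R : realType) (G : topGroupType) (n : nat) : Prop :=
  hausdorff_space G /\
  exists A : set (chart R G n),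
    [/\ smooth_atlas A, smooth_mulg A & smooth_invg A].

Definition torus (R : realType) (C : topGroupType) (d : nat) : Prop :=
  [/\ lie_group R C d, compact [set: C], connected [set: C] &
      forall x y : C, commute x y].

Definition centerg (G : topGroupType) : set G :=
  [set z | forall g : G, commute z g].
Arguments centerg : clear implicits.

(* The subgroup C of G is presented as the image of a continuous injective
   homomorphism from a torus D; when G is Hausdorff, D being compact, this is
   an isomorphism of topological groups from D onto C. *)
Definition central_torus (R : realType) (G : topGroupType) (C : set G)
    (d : nat) : Prop :=
  C `<=` centerg G /\
  exists (D : topGroupType) (i : D -> G),
    [/\ torus R D d, continuous i, {morph i : x y / (x * y)%g},
        injective i & range i = C].

Record closed_subgroup (G : topGroupType) := ClosedSubgroup {
  csub_set :> set G;
  csub1 : csub_set 1%g;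
  csubM : forall x y, csub_set x -> csub_set y -> csub_set (x * y)%g;
  csubV : forall x, csub_set x -> csub_set (x^-1)%g;
  csub_closed : closed csub_set
}.

Lemma csub_inj (G : topGroupType) : injective (@csub_set G).
Proof.
move=> [H h1 hM hV hc] [K k1 kM kV kc] /= HK; subst K.
by congr ClosedSubgroup; exact: Prop_irrelevance.
Qed.

HB.instance Definition _ (G : topGroupType) :=
  gen_eqMixin (closed_subgroup G).
HB.instance Definition _ (G : topGroupType) :=
  gen_choiceMixin (closed_subgroup G).

Definition chabauty_miss (G : topGroupType) (K : set G) :
    set (closed_subgroup G) :=
  [set H | H `&` K = set0].

Definition chabauty_hit (G : topGroupType) (U : set G) :
    set (closed_subgroup G) :=
  [set H | H `&` U !=set0].

Definition chabauty_subbase (G : topGroupType) :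
    set (set (closed_subgroup G)) :=
  [set @chabauty_miss G K | K in @compact G] `|`
  [set @chabauty_hit G U | U in @open G].

HB.instance Definition _ (G : topGroupType) :=
  @isSubBaseTopological.Build (closed_subgroup G)
    (set (closed_subgroup G)) (@chabauty_subbase G) id.

Definition one_param_subgroup (R : realType) (G : topGroupType)
    (H : set G) : Prop :=
  exists f : R -> G,
    [/\ continuous f, {morph f : s t / s + t >-> (s * t)%g} & H = range f].

Definition closed_one_param (R : realType) (G : topGroupType) :
    set (closed_subgroup G) :=
  [set H | one_param_subgroup R H].
Arguments closed_one_param : clear implicits.

Definition Subp (R : realType) (G : topGroupType) : set (closed_subgroup G) :=
  smallest closed (closed_one_param R G).
Arguments Subp : clear implicits.

Record self_homeo (X : topologicalType) := SelfHomeo {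
  homeo_fun :> X -> X;
  homeo_inv : X -> X;
  homeo_funK : cancel homeo_fun homeo_inv;
  homeo_invK : cancel homeo_inv homeo_fun;
  homeo_fun_continuous : continuous homeo_fun;
  homeo_inv_continuous : continuous homeo_inv
}.

Definition homeo_iter (X : topologicalType) (phi : self_homeo X) (n : int) :
    X -> X :=
  match n with
  | Posz k => iter k phi
  | Negz k => iter k.+1 (homeo_inv phi)
  end.

Definition compatible_metric (R : realType) (X : topologicalType)
    (d : X -> X -> R) : Prop :=
  [/\ (forall x y, d x y = 0 <-> x = y),
      (forall x y, d x y = d y x),
      (forall x y z, d x z <= d x y + d y z) &
      (forall (x : X) (U : set X),
         nbhs x U <-> exists2 e : R, 0 < e & [set y | d x y < e] `<=` U)].

(* The supremum is taken in the extended reals since d may be unbounded. *)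
Definition expansive (R : realType) (X : topologicalType)
    (phi : self_homeo X) : Prop :=
  exists2 d : X -> X -> R, compatible_metric d &
  exists2 e : R, 0 < e &
  forall x y : X, x <> y ->
    (e%:E < ereal_sup [set (d (homeo_iter phi n x) (homeo_iter phi n y))%:E |
                         n in [set: int]])%E.

Record top_aut (G : topGroupType) := TopAut {
  aut_homeo :> self_homeo G;
  autM : {morph aut_homeo : x y / (x * y)%g}
}.

Section action.
Variable G : topGroupType.
Implicit Types T : top_aut G.

Lemma aut1 T : T 1%g = 1%g.
Proof. by apply: (@mulgI _ (T 1%g)); rewrite -autM !mulg1. Qed.

Lemma autV T : {morph T : x / (x^-1)%g}.
Proof. by move=> x; apply: (@mulgI _ (T x)); rewrite -autM !mulgV aut1. Qed.

Definition aut_inv_homeo T : self_homeo G :=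
  SelfHomeo (homeo_invK T) (homeo_funK T)
    (@homeo_inv_continuous _ T) (@homeo_fun_continuous _ T).

Lemma aut_invM T : {morph aut_inv_homeo T : x y / (x * y)%g}.
Proof.
move=> x y /=; apply: (can_inj (homeo_funK T)).
by rewrite autM !homeo_invK.
Qed.

Definition top_aut_inv T : top_aut G := TopAut (@aut_invM T).

Lemma image_homeo (phi : self_homeo G) (A : set G) :
  phi @` A = homeo_inv phi @^-1` A.
Proof.
apply/seteqP; split=> [_ [x Ax <-]|y Ay] /=; first by rewrite homeo_funK.
by exists (homeo_inv phi y) => //; rewrite homeo_invK.
Qed.

Section image.
Variables (T : top_aut G) (H : closed_subgroup G).

Lemma csub_image1 : (T @` H) 1%g.
Proof. by exists 1%g; [exact: csub1|exact: aut1]. Qed.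

Lemma csub_imageM x y : (T @` H) x -> (T @` H) y -> (T @` H) (x * y)%g.
Proof.
move=> [u Hu <-] [v Hv <-]; exists (u * v)%g; [exact: csubM|exact: autM].
Qed.

Lemma csub_imageV x : (T @` H) x -> (T @` H) (x^-1)%g.
Proof. by move=> [u Hu <-]; exists (u^-1)%g; [exact: csubV|exact: autV]. Qed.

Lemma csub_image_closed : closed (T @` H).
Proof.
rewrite image_homeo; apply: preimage_closed; last exact: csub_closed.
by move=> x _; exact: homeo_inv_continuous.
Qed.

Definition csub_image : closed_subgroup G :=
  ClosedSubgroup csub_image1 csub_imageM csub_imageV csub_image_closed.

End image.

Lemma csub_imageK T : cancel (csub_image T) (csub_image (top_aut_inv T)).
Proof.
move=> H; apply: csub_inj => /=; rewrite image_comp.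
rewrite (_ : _ \o _ = id) ?image_id //.
by apply/funext => x /=; rewrite homeo_funK.
Qed.

Lemma csub_image_invK T : cancel (csub_image (top_aut_inv T)) (csub_image T).
Proof.
move=> H; apply: csub_inj => /=; rewrite image_comp.
rewrite (_ : _ \o _ = id) ?image_id //.
by apply/funext => x /=; rewrite homeo_invK.
Qed.

Lemma chabauty_subbase_open (A : set (closed_subgroup G)) :
  chabauty_subbase A -> open A.
Proof.
move=> bA; exists [set A]; last by rewrite bigcup_set1.
by move=> _ ->; exact: finI_from1.
Qed.

Lemma chabauty_continuous (f : closed_subgroup G -> closed_subgroup G) :
  (forall A, chabauty_subbase A -> open (f @^-1` A)) -> continuous f.
Proof.
move=> fb; apply/continuousP => _ [D Dfin <-].
rewrite preimage_bigcup; apply: bigcup_open => B /Dfin [F sF <-].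
rewrite preimage_bigcap openE => H FH; apply: filter_bigI => A FA.
apply: open_nbhs_nbhs; split; last exact: FH.
by apply: fb; apply/set_mem/sF.
Qed.

Lemma image_setI_homeo (phi : self_homeo G) (A B : set G) :
  phi @` A `&` B = phi @` (A `&` homeo_inv phi @` B).
Proof.
apply/seteqP; split=> [_ [[x Ax <-] By]|_ [x [Ax [y By yx]] <-]].
  by exists x => //; split => //; exists (phi x); rewrite ?homeo_funK.
by split; [exists x|rewrite -yx homeo_invK].
Qed.

Lemma csub_image_continuous T : continuous (csub_image T).
Proof.
apply: chabauty_continuous => _ [[K cK <-]|[U oU <-]];
  apply: chabauty_subbase_open.
  left; exists (homeo_inv T @` K).
    apply: continuous_compact => //.
    exact/continuous_subspaceT/homeo_inv_continuous.
  apply/seteqP; split=> H; rewrite /chabauty_miss /= image_setI_homeo.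
    by move=> ->; rewrite image_set0.
  by move/image_set0_set0.
right; exists (homeo_inv T @` U).
  rewrite -[homeo_inv T]/(homeo_fun (aut_inv_homeo T)) image_homeo /=.
  by move/continuousP : (@homeo_fun_continuous _ T); exact.
apply/seteqP; split=> H; rewrite /chabauty_hit /= image_setI_homeo.
  by move=> /(image_nonempty T).
by move=> [_ [x Hx _]]; exists x.
Qed.

Definition chabauty_homeo T : self_homeo (closed_subgroup G) :=
  SelfHomeo (csub_imageK T) (csub_image_invK T)
    (@csub_image_continuous T) (@csub_image_continuous (top_aut_inv T)).

Variable R : realType.

Lemma csub_image_closed_one_param T H :
  closed_one_param R G H -> closed_one_param R G (csub_image T H).
Proof.
move=> [f [cf fM Hf]]; exists (T \o f); split.
- move=> x; apply: continuous_comp; first exact: cf.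
  exact: homeo_fun_continuous.
- by move=> x y /=; rewrite fM autM.
- by rewrite /= Hf image_comp.
Qed.

Lemma csub_image_Subp T H : Subp R G H -> Subp R G (csub_image T H).
Proof.
move=> SH; apply: (SH (csub_image T @^-1` Subp R G)); split.
  apply: preimage_closed; first by move=> x _; exact: csub_image_continuous.
  by rewrite /Subp -closureE; exact: closed_closure.
by move=> K K1 B [_]; apply; exact: csub_image_closed_one_param.
Qed.

Definition Subp_image T (H : Subp R G) : Subp R G :=
  exist _ (csub_image T (set_val H)) (mem_set (csub_image_Subp T (set_valP H))).

Lemma Subp_imageK T : cancel (Subp_image T) (Subp_image (top_aut_inv T)).
Proof. by move=> H; apply: val_inj; exact: csub_imageK. Qed.

Lemma Subp_image_invK T : cancel (Subp_image (top_aut_inv T)) (Subp_image T).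
Proof. by move=> H; apply: val_inj; exact: csub_image_invK. Qed.

Lemma Subp_image_continuous T : continuous (Subp_image T).
Proof.
apply: continuous_comp_initial => H.
apply: (@continuous_comp _ _ _ set_val (csub_image T)).
  exact: (@initial_continuous (Subp R G) _ set_val H).
exact: csub_image_continuous.
Qed.

Definition Subp_homeo T : self_homeo (Subp R G) :=
  SelfHomeo (@Subp_imageK T) (@Subp_image_invK T)
    (@Subp_image_continuous T) (@Subp_image_continuous (top_aut_inv T)).

Definition acts_expansively_on_Subp T : Prop :=
  expansive R (Subp_homeo T).

End action.

(* Main.v *)
Require Import Defs.
From mathcomp Require Import all_boot all_order all_algebra.
From mathcomp Require Import all_classical all_reals all_analysis.
From mathcomp Require Import ring lra.

(** Call circle a one-parameter subgroup e : R -> Z(G) with e(1) = 1.  An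
    automorphism T permutes the circles.  The proof exhibits a T-invariant torus
    H in the center, a limit of images of circles, together with circles whose
    images differ from H and whose whole T-orbit stays in a prescribed Chabauty
    neighbourhood of H.  As H is a fixed point of the action on Sub^p_G, this
    contradicts expansivity ([not_expansive_near_fixed]).

    The torus.  Fix a circle e and let R[X] act on central one-parameter
    subgroups, X acting as T; [orbit_hom] is the map p |-> (p . e)(1).  In a Lie
    group of dimension n the space of central one-parameter subgroups has finite
    dimension, by a packing argument in a chart where the group law is
    x + y + O(|x| |y|) ([packing]), and the circles form a discrete subgroup of
    it.  Hence P . e is trivial for some P in Z[X] with P(0) nonzero ([orbit_relation]), and
    H = { (p . e)(1) } is compact and T-invariant.

    The circles.  For a large integer a write P(a) - P = (a - X) Q with Q in Z[X];
    the circle is Q . e, and u = Q / P(a) is the inverse of a - X modulo P.  Let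
    g = (u . e)(1), a point of that circle.  Since X u = a u - 1 modulo P and
    e(1) = 1, T sends g to its power g^a; since P(a) u is an integer polynomial, g
    has finite order.  So the finite group generated by g is T-invariant and lies
    on the image of Q . e under every T^n ([int_orbit_in]).  But this group is
    nearly dense in H: the coefficients of u are O(1/a), every p equals
    p (a - X) u modulo P, and rounding the coefficients of p (a - X) to integers
    gives an element of the group at distance O(1/a) from (p . e)(1).  The image
    of Q . e is not H as soon as e and T e are independent over R, because
    one-parameter subgroups contained in a circle are proportional
    ([range_sub_circle_dependent]).  This is [cyclic_not_expansive].

    If T e is dependent on e for every circle e, then T fixes the image of every
    circle, and for independent circles e and f the images of e(t) f(k t) tend to
    the torus generated by e and f ([scalar_not_expansive]).  Two independent
    circles come from the central torus D of dimension d >= 2: its exponential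
    map R^d -> D is a surjective homomorphism with cocompact kernel
    ([torus_circles]). *)

Set Implicit Arguments.
Unset Strict Implicit.
Unset Printing Implicit Defensive.
Import Order.TTheory GRing.Theory Num.Theory.
Import numFieldNormedType.Exports.
Local Open Scope classical_set_scope.
Local Open Scope ring_scope.

(** * Lipschitz bounds from directional derivatives *)

Section Calculus.
Variable R : realType.

Lemma rV_coord_le (n : nat) (v : 'rV[R]_n) i : `|v 0 i| <= `|v|.
Proof.
rewrite [`|v|]mx_normrE.
exact: (@le_bigmax _ _ _ 0 (fun ij : 'I_1 * 'I_n => `|v ij.1 ij.2|) (0, i)).
Qed.

Lemma rV_norm_le (n : nat) (v : 'rV[R]_n) (e : R) : 0 <= e ->
  (forall i, `|v 0 i| <= e) -> `|v| <= e.
Proof.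
move=> e0 h; rewrite [`|v|]mx_normrE; apply: bigmax_le => // -[a i] _ /=.
by rewrite (ord1 a).
Qed.

Lemma is_derive_line (V : normedModType R) (m : nat) (f : V -> 'rV[R]_m)
    (x v : V) (s : R) (j : 'I_m) :
  derivable f (x + s *: v) v ->
  is_derive s 1 (fun t : R => f (x + t *: v) 0 j) ('D_v f (x + s *: v) 0 j).
Proof.
move=> df; rewrite (derive_mx df) mxE.
have E : forall h : R, (h *: (1 : R) + s) = s + h.
  by move=> h; rewrite /GRing.scale /= mulr1 addrC.
have dj := (derivable_mxP f _ v).1 df 0 j.
have E2 : forall h : R, h *: v + (x + s *: v) = x + (s + h) *: v.
  by move=> h; rewrite scalerDl addrCA [s *: v + _]addrC.
have EE : (fun h : R => h^-1 *: (((fun t : R => f (x + t *: v) 0 j) \o shift s) (h *: 1) -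
     f (x + s *: v) 0 j)) = (fun h : R => h^-1 *: (((fun t => f t 0 j) \o shift (x + s *: v)) (h *: v) -
     f (x + s *: v) 0 j)).
  by apply/funext => h /=; rewrite E E2.
by split; rewrite /derivable /derive EE.
Qed.

(** The mean value theorem, applied to each coordinate of f along the line. *)
Lemma directional_lip (V : normedModType R) (m : nat) (f : V -> 'rV[R]_m)
    (x v : V) (c M : R) : 0 <= M ->
  (forall s, `|s| <= `|c| -> derivable f (x + s *: v) v /\
      `|'D_v f (x + s *: v)| <= M) ->
  `|f (x + c *: v) - f x| <= M * `|c|.
Proof.
move=> M0 H; apply: rV_norm_le => [|j]; first by rewrite mulr_ge0.
rewrite !mxE.
pose g (t : R) := f (x + t *: v) 0 j.
have -> : f x 0 j = g 0 by rewrite /g scale0r addr0.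
rewrite -/(g c).
have key a b : a <= b -> (forall s, s \in `[a, b]%R -> `|s| <= `|c|) ->
    `|g b - g a| <= M * `|b - a|.
  move=> ab sc.
  have dg s : s \in `[a, b]%R -> is_derive s 1 g ('D_v f (x + s *: v) 0 j).
    by move=> /sc /H [df _]; exact: is_derive_line.
  have der s : s \in `]a, b[%R -> is_derive s 1 g ('D_v f (x + s *: v) 0 j).
    by move=> /subset_itv_oo_cc; exact: dg.
  have cont : {within `[a, b], continuous g}.
    apply: derivable_within_continuous => s sab; have := dg s sab.
    by move=> [].
  have [s sab ->] := MVT_segment ab der cont.
  rewrite normrM ler_wpM2r //.
  by apply: le_trans (rV_coord_le _ _) _; exact: (H s (sc s sab)).2.
have [c0|c0] := leP 0 c.
  rewrite -[X in _ * `|X|]subr0; apply: key => // s.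
  by rewrite in_itv /= => /andP[s0 sc]; rewrite !ger0_norm.
rewrite -normrN opprB -[`|c|]normrN -[X in _ * `|X|]add0r; apply: key; first exact: ltW.
move=> s; rewrite in_itv /= => /andP[s0 sc]; rewrite !ler0_norm //; last exact: ltW.
by rewrite lerN2.
Qed.

Definition axis (n : nat) (i : 'I_n) : 'rV[R]_n := delta_mx 0 i.

(** Only partial derivatives are bounded here: going from x to x + h along the
    axes, one coordinate after the other, never leaves the box of radius |h|. *)
Lemma coordinatewise_lip (n m : nat) (f : 'rV[R]_n -> 'rV[R]_m) (x h : 'rV[R]_n)
    (M : R) : 0 <= M ->
  (forall k, `|k| <= `|h| -> forall i, derivable f (x + k) (axis i) /\
      `|'D_(axis i) f (x + k)| <= M) ->
  `|f (x + h) - f x| <= n%:R * M * `|h|.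
Proof.
move=> M0 H.
(* h with all but its first l coordinates set to 0 *)
pose tr (l : nat) : 'rV[R]_n := \row_i (if (i < l)%N then h 0 i else 0).
suff main l : (l <= n)%N -> `|f (x + tr l) - f x| <= l%:R * M * `|h|.
  have hE : tr n = h by apply/rowP => i; rewrite mxE ltn_ord.
  by rewrite -[in f (x + h)]hE; exact: main.
elim: l => [_|l IH ln].
  have -> : tr 0%N = 0 by apply/rowP => i; rewrite !mxE.
  by rewrite addr0 subrr normr0 !mul0r.
pose i := Ordinal ln.
have trS : tr l.+1 = tr l + h 0 i *: axis i.
  apply/rowP => k; rewrite !mxE eqxx /= ltnS leq_eqVlt.
  have [ki|ki] := eqVneq k i.
    by rewrite ki /= eqxx ltnn mulr1 add0r.
  rewrite (_ : (k == l :> nat) = false) /= ?mulr0 ?addr0 //.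
  by apply/eqP => kl; move/eqP: ki; apply; apply: val_inj.
rewrite trS (addrA x).
have -> : f (x + tr l + h 0 i *: axis i) - f x =
   (f (x + tr l + h 0 i *: axis i) - f (x + tr l)) + (f (x + tr l) - f x).
  by rewrite addrA subrK.
apply: le_trans (ler_normD _ _) _.
have -> : l.+1%:R * M * `|h| = M * `|h| + l%:R * M * `|h|.
  by rewrite -natr1; ring.
apply: lerD; last exact/IH/ltnW.
apply: (@le_trans _ _ (M * `|h 0 i|)); last by rewrite ler_wpM2l // rV_coord_le.
apply: directional_lip => // s sh; rewrite -addrA; apply: H.
apply: rV_norm_le => // k; rewrite !mxE eqxx /=.
have [ki|ki] := eqVneq k i.
  by rewrite ki /= ltnn mulr1 add0r; apply: le_trans sh (rV_coord_le _ _).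
rewrite mulr0 addr0; case: ifP => _; first exact: rV_coord_le.
by rewrite normr0.
Qed.

Lemma derive_slice1 (V W : normedModType R) (D : V * V -> W) (a b v : V) :
  derivable D (a, b) (v, 0) ->
  derivable (fun x => D (x, b)) a v /\
  'D_v (fun x => D (x, b)) a = 'D_(v, 0) D (a, b).
Proof.
rewrite /derivable /derive.
rewrite (_ : (fun t : R => _) = fun t : R =>
  t^-1 *: (((fun x => D (x, b)) \o shift a) (t *: v) - D (a, b))) //.
apply/funext => t /=.
by rewrite (_ : t *: (v, 0) + (a, b) = (t *: v + a, t *: 0 + b)) // scaler0 add0r.
Qed.

Lemma derive_slice2 (V W : normedModType R) (D : V * V -> W) (a b v : V) :
  derivable D (a, b) (0, v) ->
  derivable (fun y => D (a, y)) b v /\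
  'D_v (fun y => D (a, y)) b = 'D_(0, v) D (a, b).
Proof.
rewrite /derivable /derive.
rewrite (_ : (fun t : R => _) = fun t : R =>
  t^-1 *: (((fun y => D (a, y)) \o shift b) (t *: v) - D (a, b))) //.
apply/funext => t /=.
by rewrite (_ : t *: (0, v) + (a, b) = (t *: 0 + a, t *: v + b)) // scaler0 add0r.
Qed.

(** The mixed second difference of F is controlled by the mixed second
    derivatives: the increment of F in its second variable is a function of
    the first variable whose partial derivatives are increments of partial
    derivatives of F, hence O(|k|). *)
Lemma mixed_difference (n m : nat) (F : 'rV[R]_n * 'rV[R]_n -> 'rV[R]_m)
    (U : set ('rV[R]_n * 'rV[R]_n)) (p : 'rV[R]_n * 'rV[R]_n) :
  open U -> U p -> Ck 2 U F ->
  exists r C : R, [/\ 0 < r, 0 <= C &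
    forall h k, `|h| <= r -> `|k| <= r -> U (p.1 + h, p.2 + k) /\
      `|F (p.1 + h, p.2 + k) - F (p.1 + h, p.2)
        - (F (p.1, p.2 + k) - F (p.1, p.2))| <= C * `|h| * `|k|].
Proof.
move=> oU Up [_ dF].
pose e1 i : 'rV[R]_n * 'rV[R]_n := (axis i, 0).
pose e2 i : 'rV[R]_n * 'rV[R]_n := (0, axis i).
pose D1 i := 'D_(e1 i) F.
pose D2 i j := 'D_(e2 j) (D1 i).
have D1F i q : U q -> derivable F q (e1 i) by exact: (dF (e1 i)).1.
have D2F i j q : U q -> derivable (D1 i) q (e2 j).
  by case: (dF (e1 i)) => _ [_ /(_ (e2 j))[+ _]]; apply.
have D2c i j : {for p, continuous (D2 i j)}.
  by case: (dF (e1 i)) => _ [_ /(_ (e2 j))[_ [+ _]]]; apply.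
pose M := 1 + \big[Num.max/0]_(ij : 'I_n * 'I_n) `|D2 ij.1 ij.2 p|.
have M0 : 0 <= M.
  by apply: addr_ge0 => //; elim/big_ind: _ => // x y x0 y0; rewrite le_max x0.
have near_p : \forall q \near p, U q /\ forall ij : 'I_n * 'I_n, `|D2 ij.1 ij.2 q| <= M.
  apply: filterI; first exact: open_nbhs_nbhs.
  suff near_ij (ij : 'I_n * 'I_n) : \forall q \near p, `|D2 ij.1 ij.2 q| <= M.
    exact: (filter_forall _ near_ij).
  have /cvgrPdist_lt/(_ 1 ltr01) := D2c ij.1 ij.2.
  apply: filterS => q /ltW hq; rewrite -(subrK (D2 ij.1 ij.2 p) (D2 ij.1 ij.2 q)).
  apply: le_trans (ler_normD _ _) _; rewrite distrC lerD //.
  exact: (@le_bigmax _ _ _ 0 (fun ij : 'I_n * 'I_n => `|D2 ij.1 ij.2 p|) ij).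
have /nbhs_ballP[e /= e0 be] := near_p.
pose r := e / 2.
have r0 : 0 < r by rewrite divr_gt0.
have box h k : `|h| <= r -> `|k| <= r ->
    U (p.1 + h, p.2 + k) /\ forall ij : 'I_n * 'I_n, `|D2 ij.1 ij.2 (p.1 + h, p.2 + k)| <= M.
  move=> hr kr; apply: be; split => /=; rewrite -ball_normE /ball_ /= opprD addrA subrr
    sub0r normrN; apply: le_lt_trans (_ : r < e) => //; rewrite /r; lra.
exists r, (n%:R * (n%:R * M)); split => //; first by rewrite !mulr_ge0.
move=> h k hr kr; split; first exact: (box h k hr kr).1.
pose g (x : 'rV[R]_n) := F (x, p.2 + k) - F (x, p.2).
rewrite -/(g (p.1 + h)) -/(g p.1).
have kN : 0 <= n%:R * M * `|k| by rewrite !mulr_ge0.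
rewrite (_ : _ * `|h| * `|k| = n%:R * (n%:R * M * `|k|) * `|h|); last by ring.
apply: (@coordinatewise_lip n m g p.1 h _ kN) => h' hh' i.
have h'r := le_trans hh' hr.
have line k' (k'r : `|k'| <= r) := derive_slice1 (D1F i _ (box h' k' h'r k'r).1).
have [d1 v1] := line k kr.
have n0 : `|0 : 'rV[R]_n| <= r by rewrite normr0 ltW.
have [d2 v2] := line 0 n0; rewrite addr0 in d2 v2.
have gE : g = (fun x => F (x, p.2 + k)) - (fun x => F (x, p.2)) by [].
split; first by rewrite gE; apply: derivableB d1 d2.
rewrite gE (deriveB d1 d2) v1 v2.
apply: (@coordinatewise_lip n m (fun y => D1 i (p.1 + h', y)) p.2 k M M0) => k' kk' j.
have k'r := le_trans kk' kr.
have [d ->] := derive_slice2 (D2F i j _ (box h' k' h'r k'r).1).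
by split => //; exact: (box h' k' h'r k'r).2 (i, j).
Qed.

End Calculus.

(** * The group law near the identity *)

Section LocalChart.
Variables (R : realType) (G : topGroupType) (n : nat).

Lemma mulg_cvg (T : Type) (F : set_system T) {FF : Filter F} (f g : T -> G) (a b : G) :
  f x @[x --> F] --> a -> g x @[x --> F] --> b ->
  (f x * g x)%g @[x --> F] --> (a * b)%g.
Proof.
move=> fa gb.
apply: (@cvg_comp _ _ _ (fun x => (f x, g x)) (fun p : G * G => (p.1 * p.2)%g) F).
  exact: cvg_pair fa gb.
exact: (@mulg_continuous G (a, b)).
Qed.

Lemma invg_cvg (T : Type) (F : set_system T) {FF : Filter F} (f : T -> G) (a : G) :
  f x @[x --> F] --> a -> ((f x)^-1)%g @[x --> F] --> (a^-1)%g.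
Proof.
move=> fa; apply: (@cvg_comp _ _ _ f (fun p : G => (p^-1)%g) F _ _ fa).
exact: (@invg_continuous G a).
Qed.

Lemma prod_open (a b c : chart R G n) :
  open [set p : 'rV[R]_n * 'rV[R]_n |
        [/\ chart_cod a p.1, chart_cod b p.2 &
            chart_dom c (chart_inv a p.1 * chart_inv b p.2)%g]].
Proof.
rewrite openE => p [ap bp cp].
have c1 : (fun q : 'rV[R]_n * 'rV[R]_n => chart_inv a q.1) q @[q --> p] --> chart_inv a p.1.
  by apply: cvg_comp; [exact: cvg_fst|exact: chart_inv_continuous].
have c2 : (fun q : 'rV[R]_n * 'rV[R]_n => chart_inv b q.2) q @[q --> p] --> chart_inv b p.2.
  by apply: cvg_comp; [exact: cvg_snd|exact: chart_inv_continuous].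
have c3 := mulg_cvg c1 c2.
have n1 : \forall q \near p, chart_cod a q.1.
  have := @cvg_fst _ _ (nbhs p.1) (nbhs p.2) _; apply.
  by apply: open_nbhs_nbhs; split => //; exact: chart_cod_open.
have n2 : \forall q \near p, chart_cod b q.2.
  have := @cvg_snd _ _ (nbhs p.1) (nbhs p.2) _; apply.
  by apply: open_nbhs_nbhs; split => //; exact: chart_cod_open.
have n3 : \forall q \near p, chart_dom c (chart_inv a q.1 * chart_inv b q.2)%g.
  apply: c3.
  by apply: open_nbhs_nbhs; split => //; exact: chart_dom_open.
by near=> q; split; near: q.
Unshelve. all: by end_near. Qed.

(** Coordinates at the identity in which the group law is x + y up to a
    bilinear error.  The radius r bounds the domain on which they are used. *)
Record linearizing (psi : 'rV[R]_n -> G) (r C : R) : Prop := Linearizing {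
  lin_r0 : 0 < r;
  lin_C0 : 0 <= C;
  lin1 : psi 0 = 1%g;
  lin_inj : forall x y, `|x| <= r -> `|y| <= r -> psi x = psi y -> x = y;
  lin_cont : forall x, `|x| <= r -> {for x, continuous psi};
  lin_near : forall s, 0 < s ->
    \forall g \near (1%g : G), exists2 y, `|y| <= s & g = psi y;
  lin_mul : forall x y, `|x| <= r -> `|y| <= r ->
    exists2 z, (psi x * psi y)%g = psi z & `|z - (x + y)| <= C * `|x| * `|y|;
  lin_div : forall x y, `|x| <= r -> `|y| <= r ->
    exists2 z, (psi x * (psi y)^-1)%g = psi z & `|z| <= 2 * `|x - y|
}.

(** With F the group law read in a chart centred at 1, F(x, 0) = x and
    F(0, y) = y, so F(x, y) - x - y is the mixed difference of F at 0 and is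
    O(|x| |y|).  Division follows: if psi x = psi z psi y then
    x = z + y + O(|z| |y|), so |x - y| is comparable to |z| once y is small. *)
Lemma lie_group_linearizing : lie_group R G n ->
  exists (psi : 'rV[R]_n -> G) (r C : R), linearizing psi r C.
Proof.
move=> [hG [A [[cover _] /(_ _ _ _)smM _]]].
have [a Aa a1] := cover 1%g.
pose x0 := chart_fun a 1%g.
pose psi (x : 'rV[R]_n) := chart_inv a (x0 + x).
have ix0 : chart_inv a x0 = 1%g by exact: chart_funK.
have psi0 : psi 0 = 1%g by rewrite /psi addr0.
pose F (p : 'rV[R]_n * 'rV[R]_n) := chart_fun a (chart_inv a p.1 * chart_inv a p.2)%g.
have Ux0 : [set p : 'rV[R]_n * 'rV[R]_n |
        [/\ chart_cod a p.1, chart_cod a p.2 &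
            chart_dom a (chart_inv a p.1 * chart_inv a p.2)%g]] (x0, x0).
  by rewrite /= ix0 mulg1; split => //; exact: chart_fun_cod.
have [r1 [C [r10 C0 /= mixed]]] := mixed_difference (@prod_open a a a) Ux0 (smM a a a Aa Aa Aa 2%N).
have z1 : `|0 : 'rV[R]_n| <= r1 by rewrite normr0 ltW.
have cod x : `|x| <= r1 -> chart_cod a (x0 + x).
  by move=> xr; have [[+ _ _] _] := mixed x 0 xr z1.
have inj x y : `|x| <= r1 -> `|y| <= r1 -> psi x = psi y -> x = y.
  move=> xr yr xy; apply: (@addrI _ x0).
  by rewrite -(chart_invK (cod x xr)) -(chart_invK (cod y yr)) -/(psi x) xy.
have cont x : `|x| <= r1 -> {for x, continuous psi}.
  move=> xr; rewrite /prop_for /continuous_at.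
  have c0 : x0 + y @[y --> x] --> x0 + x.
    have := @cvgD R 'rV[R]_n _ (nbhs x) _ (fun=> x0) id x0 x.
    by apply; [exact: cvg_cst|exact: cvg_id].
  apply: cvg_comp c0 _; exact: (chart_inv_continuous (cod x xr)).
have near1 s : 0 < s -> \forall g \near (1%g : G), exists2 y, `|y| <= s & g = psi y.
  move=> s0.
  have n1 : \forall g \near (1%g : G), chart_dom a g.
    by apply: open_nbhs_nbhs; split => //; exact: chart_dom_open.
  have /cvgrPdist_lt/(_ s s0) n2 := chart_fun_continuous a1.
  near=> g.
  exists (chart_fun a g - x0).
    by rewrite distrC; apply: ltW; near: g.
  rewrite /psi addrC subrK chart_funK //; near: g; exact: n1.
have mult x y : `|x| <= r1 -> `|y| <= r1 -> exists2 z, (psi x * psi y)%g = psi z &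
        `|z - (x + y)| <= C * `|x| * `|y|.
  move=> xr yr; have [[cx cy d]] := mixed x y xr yr.
  rewrite ix0 !mulg1 !mul1g (chart_invK (cod x xr)) (chart_invK (cod y yr)) -/x0.
  move=> E; exists (F (x0 + x, x0 + y) - x0).
    rewrite -[RHS]/(chart_inv a (x0 + (F (x0 + x, x0 + y) - x0))).
    by rewrite (addrC x0 (_ - x0)) subrK /F chart_funK.
  apply: le_trans E; rewrite le_eqVlt; apply/orP; left; apply/eqP; congr (`|_|).
  rewrite /F /= [x0 + y - x0]addrAC subrr add0r !opprD !addrA.
  by congr (_ - _); rewrite -addrA -[RHS]addrA.
(* lin_div needs beforehand that the quotient lies in the range of the chart *)
have divc : (fun p : 'rV[R]_n * 'rV[R]_n => (psi p.1 * (psi p.2)^-1)%g) q @[q --> ((0 : 'rV[R]_n), (0 : 'rV[R]_n))] --> (1%g : G).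
  have <- : (psi 0 * (psi 0)^-1)%g = 1%g by rewrite mulgV.
  apply: mulg_cvg.
    by apply: cvg_comp; [exact: cvg_fst|exact: cont].
  apply: invg_cvg.
  by apply: cvg_comp; [exact: cvg_snd|exact: cont].
have r130 : 0 < r1 / 3 by rewrite divr_gt0.
have /nbhs_ballP[e /= e0 be] := divc _ (near1 _ r130).
pose r2 := Num.min (e / 2) (Num.min (r1 / 3) (2 * (C + 1))^-1).
have r20 : 0 < r2.
  by rewrite !lt_min !divr_gt0 //= invr_gt0 mulr_gt0 // ltr_wpDl.
have r2r1 : r2 <= r1 / 3 by rewrite /r2 !ge_min lexx orbT.
have r2e : r2 < e by rewrite gt_min ltr_pdivrMr // ltr_pMr // ltr1n.
have r2C : C * r2 <= 1 / 2.
  apply: (@le_trans _ _ (C * (2 * (C + 1))^-1)).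
    by rewrite ler_wpM2l // /r2 !ge_min lexx !orbT.
  have C1 : 0 < C + 1 by rewrite ltr_wpDl.
  rewrite ler_pdivrMr ?mulr_gt0 //; lra.
have le21 (x : 'rV[R]_n) : `|x| <= r2 -> `|x| <= r1 by move=> xr; lra.
exists psi, r2, C; split => //.
- by move=> x y xr yr; apply: inj; exact: le21.
- by move=> x xr; apply: cont; exact: le21.
- by move=> x y xr yr; apply: mult; exact: le21.
move=> x y xr yr.
have [|z zr E] := be (x, y).
  by split => /=; rewrite -ball_normE /ball_ /= sub0r normrN; exact: le_lt_trans r2e.
rewrite /= in E; exists z => //.
have zr1 : `|z| <= r1 by lra.
have [z' Ez' dz'] := mult z y zr1 (le21 _ yr).
have hz : C * `|z| * `|y| <= `|z| / 2.
  have : C * `|y| <= 1 / 2 by apply: le_trans r2C; rewrite ler_wpM2l.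
  move=> Cy; have := ler_wpM2r (normr_ge0 z) Cy; lra.
have z'r : `|z'| <= r1.
  rewrite -(subrK (z + y) z'); apply: le_trans (ler_normD _ _) _.
  have := ler_normD z y; lra.
have xz' : x = z'.
  apply: inj => //; first exact: le21.
  by rewrite -Ez' -E mulgVK.
move: dz'; rewrite -xz' => dz'.
have : `|z| <= `|x - y| + `|x - (z + y)|.
  have {1}-> : z = (x - y) - (x - (z + y)).
    by rewrite opprB addrC addrA subrK addrK.
  exact: ler_normB.
lra.
Unshelve. all: by end_near. Qed.

End LocalChart.

(** * Homomorphisms from vector spaces, and powers of small elements *)

Section Homs.
Variables (G : topGroupType) (V : zmodType) (f : V -> G).
Hypothesis fD : {morph f : x y / x + y >-> (x * y)%g}.

Lemma hom0 : f 0 = 1%g.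
Proof. by apply: (@mulgI _ (f 0)); rewrite -fD addr0 mulg1. Qed.

Lemma homN x : f (- x) = ((f x)^-1)%g.
Proof. by apply: (@mulgI _ (f x)); rewrite -fD mulgV subrr hom0. Qed.

Lemma homB x y : f (x - y) = (f x * (f y)^-1)%g.
Proof. by rewrite fD homN. Qed.

Lemma homMn x k : f (x *+ k) = (f x ^+ k)%g.
Proof. by elim: k => [|k IH]; rewrite ?mulr0n ?hom0 // mulrS expgS fD IH. Qed.

End Homs.

Lemma hom_continuous (R : realType) (W : normedModType R) (G : topGroupType)
    (f : W -> G) :
  {morph f : x y / x + y >-> (x * y)%g} -> {for 0, continuous f} ->
  continuous f.
Proof.
move=> fD f0 x.
have c : (f x * f (y - x))%g @[y --> x] --> (f x * f 0)%g.
  apply: mulg_cvg; first exact: cvg_cst.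
  have c0 : (y - x) @[y --> x] --> x - x.
    have := @cvgD R W _ (nbhs x) _ id (fun=> - x) x (- x).
    by apply; [exact: cvg_id|exact: cvg_cst].
  rewrite subrr in c0; apply: cvg_comp c0 _; exact: f0.
rewrite (hom0 fD) mulg1 in c; apply: cvg_trans c.
apply: near_eq_cvg; apply: nearW => y.
by rewrite -fD addrC subrK.
Qed.

Section IntegerParameters.
Variables (R : realType) (G : topGroupType) (w : R -> G).
Hypothesis wD : {morph w : s t / s + t >-> (s * t)%g}.
Hypothesis w1 : w 1 = 1%g.

Lemma param_nat m : w m%:R = 1%g.
Proof. by rewrite -[m%:R]/(1 *+ m) (homMn wD) w1 expg1n. Qed.

Lemma param_int z : w z%:~R = 1%g.
Proof.
by case: z => m; [exact: param_nat|rewrite NegzE mulrNz (homN wD) -pmulrn param_nat invg1].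
Qed.

Lemma param_frac t : w t = w (t - (Num.floor t)%:~R).
Proof. by rewrite (homB wD) param_int invg1 mulg1. Qed.

End IntegerParameters.

Lemma frac_itv (R : realType) (t : R) : 0 <= t - (Num.floor t)%:~R <= 1.
Proof. by have := floor_itv t; rewrite intrD /= => /andP[h1 h2]; lra. Qed.

Lemma ultra_fmap (T U : Type) (f : T -> U) (F : set_system T) :
  UltraFilter F -> UltraFilter (f @ F).
Proof.
move=> FU; apply: Build_UltraFilter => H HP FH.
apply/seteqP; split => [A HA|]; last exact: FH.
have [//|FA] := in_ultra_setVsetC (f @^-1` A) FU.
have : H (A `&` ~` A) by apply: filterI => //; apply: FH.
by rewrite setICr => /filter_not_empty.
Qed.

Lemma closed_ballrV_compact (R : realType) (n : nat) (a : 'rV[R]_n) (s : R) :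
  compact [set y : 'rV[R]_n | `|y - a| <= s].
Proof.
apply: bounded_closed_compact.
  exists (`|a| + s); split; first exact: num_real.
  move=> M hM y /= ys; apply: ltW; apply: le_lt_trans hM.
  rewrite -{1}(subrK a y) addrC; apply: le_trans (ler_normD _ _) _.
  by rewrite lerD2l.
apply: (@closed_comp _ _ (fun y : 'rV[R]_n => `|y - a|) [set x : R | x <= s]); last exact: closed_le.
move=> y _.
have := @cvg_norm _ _ _ (nbhs y) _ (fun y => y - a) (y - a); apply.
have := @cvgD R 'rV[R]_n _ (nbhs y) _ id (fun=> - a) y (- a).
by apply; [exact: cvg_id|exact: cvg_cst].
Qed.

Section Linearizing.
Variables (R : realType) (G : topGroupType) (n : nat).
Variables (psi : 'rV[R]_n -> G) (r C : R).
Hypothesis lin : linearizing psi r C.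
Hypothesis hG : hausdorff_space G.

Lemma lin_ball_closed (a : 'rV[R]_n) (s : R) : `|a| + s <= r ->
  closed [set psi y | y in [set y | `|y - a| <= s]].
Proof.
move=> asr; apply: compact_closed => //; apply: continuous_compact.
  apply: continuous_in_subspaceT => y /set_mem /= ys.
  apply: (lin_cont lin); apply: le_trans asr.
  rewrite -{1}(subrK a y) addrC; apply: le_trans (ler_normD _ _) _.
  by rewrite lerD2l.
exact: closed_ballrV_compact.
Qed.

Lemma lin_eq1 (g : G) : (forall s, 0 < s -> exists2 y, `|y| <= s & g = psi y) -> g = 1%g.
Proof.
move=> H; have [y yr Ey] := H r (lin_r0 lin).
suff y0 : y = 0 by rewrite Ey y0 (lin1 lin).
apply/eqP; rewrite -normr_le0; apply/ler_addgt0Pl => e e0; rewrite addr0.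
have me : 0 < Num.min e r by rewrite lt_min e0 (lin_r0 lin).
have [y' y'e E] := H _ me.
have le_me : Num.min e r <= e /\ Num.min e r <= r by rewrite !ge_min !lexx orbT.
have y'r : `|y'| <= r by apply: le_trans y'e le_me.2.
by rewrite (lin_inj lin yr y'r (etrans (esym Ey) E)); apply: le_trans y'e le_me.1.
Qed.

Lemma lin_cvg1 (T : Type) (F : set_system T) {FF : ProperFilter F} (f : T -> G) (g : G) :
  f x @[x --> F] --> g ->
  (forall s, 0 < s -> \forall x \near F, exists2 y, `|y| <= s & f x = psi y) ->
  g = 1%g.
Proof.
move=> fg H; apply: lin_eq1 => s s0.
have ms : 0 < Num.min s r by rewrite lt_min s0 (lin_r0 lin).
have [ms1 ms2] : Num.min s r <= s /\ Num.min s r <= r by rewrite !ge_min !lexx orbT.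
have cl : closed [set psi y | y in [set y | `|y - 0| <= Num.min s r]].
  by apply: lin_ball_closed; rewrite normr0 add0r.
have [|y /= ys <-] := closed_cvg _ cl _ g fg.
  apply: filterS (H _ ms) => x [y ys ->]; exists y => //=.
  by rewrite subr0.
by exists y => //; rewrite subr0 in ys; apply: le_trans ys ms1.
Qed.

(** Powers of a small element follow the straight line: the error made at each
    of the N steps is at most 2CN|x|^2. *)
Lemma lin_expg (x : 'rV[R]_n) (N : nat) :
  2 * (N%:R * `|x|) <= r -> C * (N%:R * `|x|) <= 1 ->
  exists2 y, (psi x ^+ N)%g = psi y & `|y - N%:R *: x| <= C * (N%:R * `|x|) ^+ 2.
Proof.
elim: N => [|N IH] Nr NC.
  exists 0; first by rewrite expg0 (lin1 lin).
  by rewrite scale0r subr0 normr0 mul0r expr0n /= mulr0.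
have leN : N%:R * `|x| <= N.+1%:R * `|x| by rewrite ler_wpM2r // ler_nat.
have x0 := normr_ge0 x; have C0 := lin_C0 lin.
have N0 : 0 <= N%:R * `|x| by rewrite mulr_ge0.
have CN : C * (N%:R * `|x|) <= 1 by apply: le_trans NC; rewrite ler_wpM2l.
have [||y Ey dy] := IH _ _ => //; first by lra.
have yN : `|y| <= 2 * (N%:R * `|x|).
  rewrite -(subrK (N%:R *: x) y); apply: le_trans (ler_normD _ _) _.
  rewrite normrZ normr_nat.
  have : C * (N%:R * `|x|) * (N%:R * `|x|) <= 1 * (N%:R * `|x|) by rewrite ler_wpM2r.
  by rewrite -mulrA -expr2; lra.
have yr : `|y| <= r by apply: le_trans yN _; lra.
have xr : `|x| <= r.
  have : 1 * `|x| <= N.+1%:R * `|x| by rewrite ler_wpM2r // ler1n.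
  by lra.
have [z Ez dz] := lin_mul lin yr xr.
exists z; first by rewrite expgSr Ey Ez.
have -> : z - N.+1%:R *: x = (z - (y + x)) + (y - N%:R *: x).
  by apply/rowP => i; rewrite !mxE -natr1; ring.
apply: le_trans (ler_normD _ _) _.
have : C * `|y| * `|x| <= C * (2 * (N%:R * `|x|)) * `|x|.
  by rewrite ler_wpM2r // ler_wpM2l.
have : 0 <= C * `|x| ^+ 2 by rewrite mulr_ge0 // exprn_ge0.
have -> : C * (N.+1%:R * `|x|) ^+ 2 = C * (N%:R * `|x|) ^+ 2 + C * (2 * (N%:R * `|x|)) * `|x| + C * `|x| ^+ 2.
  by rewrite -natr1; ring.
lra.
Qed.
End Linearizing.

(** * The exponential map of a compact abelian Lie group *)

Section Exponential.
Variables (R : realType) (D : topGroupType) (n : nat).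
Variables (psi : 'rV[R]_n -> D) (r C : R).
Hypothesis lin : linearizing psi r C.
Hypothesis hD : hausdorff_space D.
Hypothesis cD : compact [set: D].
Hypothesis abD : forall x y : D, commute x y.

Let rho : R := Num.min (r / 2) (C + 1)^-1.

Let rho_gt0 : 0 < rho.
Proof.
by rewrite lt_min divr_gt0 ?(lin_r0 lin) //= invr_gt0 ltr_wpDl ?(lin_C0 lin).
Qed.

Let rho_r : 2 * rho <= r.
Proof.
have : rho <= r / 2 by rewrite ge_min lexx.
lra.
Qed.

Let rho_C : C * rho <= 1.
Proof.
have h : rho <= (C + 1)^-1 by rewrite ge_min lexx orbT.
have C0 := lin_C0 lin; have C1 : 0 < C + 1 by rewrite ltr_wpDl.
apply: (@le_trans _ _ (C * (C + 1)^-1)); first by rewrite ler_wpM2l.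
rewrite ler_pdivrMr //; lra.
Qed.

Let expg_rho (x : 'rV[R]_n) (N : nat) : N%:R * `|x| <= rho ->
  exists2 y, (psi x ^+ N)%g = psi y & `|y - N%:R *: x| <= C * (N%:R * `|x|) ^+ 2.
Proof.
move=> h; apply: (lin_expg lin).
  by apply: le_trans rho_r; rewrite ler_wpM2l.
by apply: le_trans rho_C; rewrite ler_wpM2l // (lin_C0 lin).
Qed.

Let half (k : nat) (x : 'rV[R]_n) : 'rV[R]_n := ((2 ^ k)%N%:R)^-1 *: x.

Let half_norm k x : `|half k x| = ((2 ^ k)%N%:R)^-1 * `|x|.
Proof. by rewrite normrZ ger0_norm // invr_ge0. Qed.

Let pow2_gt0 k : 0 < ((2 ^ k)%N%:R : R).
Proof. by rewrite ltr0n expn_gt0. Qed.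

Let half_small (x : 'rV[R]_n) (s : R) : 0 < s -> \forall k \near \oo, `|half k x| <= s.
Proof.
move=> s0; exists (Num.bound (`|x| / s)) => // k /= xk.
rewrite half_norm mulrC ler_pdivrMr // mulrC -ler_pdivrMr //.
apply: ltW; apply: lt_le_trans (archi_boundP _) _; first by rewrite divr_ge0 // ltW.
by rewrite ler_nat; apply: leq_trans xk _; apply: ltnW; exact: ltn_expl.
Qed.

(** The exponential map is the limit of psi(x/2^k)^(2^k), taken along an
    ultrafilter so that compactness alone makes it exist.  It is additive because
    psi(x/2^k) psi(y/2^k) and psi((x+y)/2^k) differ by an element of size O(4^-k),
    whose power 2^k is still O(2^-k), and in an abelian group that power is the
    quotient of the powers. *)
Lemma compact_abelian_exp : exists (E : 'rV[R]_n -> D) (e : R),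
  [/\ 0 < e, {morph E : x y / x + y >-> (x * y)%g} &
      forall x, `|x| <= e -> exists2 y, E x = psi y & `|y - x| <= C * `|x| ^+ 2].
Proof.
have [U [UU ooU]] := ultraFilterLemma eventually_filter.
have C0 := lin_C0 lin.
have /choice[E Elim] : forall x, exists g : D, (psi (half k x) ^+ (2 ^ k))%g @[k --> U] --> g.
  move=> x.
  have := cD; rewrite compact_ultra => /(_ _ (ultra_fmap (fun k => (psi (half k x) ^+ (2 ^ k))%g) UU)).
  by move=> /(_ filterT)[g [_ gU]]; exists g.
have PU : ProperFilter U by exact: ultra_proper.
have Eexp : forall x, `|x| <= rho -> exists2 y, E x = psi y & `|y - x| <= C * `|x| ^+ 2.
  move=> x xr.
  have cl : closed [set psi y | y in [set y | `|y - x| <= C * `|x| ^+ 2]].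
    apply: (lin_ball_closed lin hD).
    have : C * `|x| * `|x| <= 1 * `|x|.
      by rewrite ler_wpM2r //; apply: le_trans rho_C; rewrite ler_wpM2l.
    have := rho_r; rewrite expr2 mulrA; lra.
  have [|y /= yx <-] := closed_cvg _ cl _ _ (Elim x); last by exists y.
  apply: nearW => k.
  have kx : (2 ^ k)%N%:R * `|half k x| = `|x| by rewrite half_norm mulVKf // gt_eqF.
  have [|y -> dy] := @expg_rho (half k x) (2 ^ k); first by rewrite kx.
  exists y => //=; move: dy; rewrite kx.
  by rewrite /half scalerA divff ?scale1r // gt_eqF.
exists E, rho; split => // x y.
apply/esym/divg1_eq.
have lim : ((psi (half k x) * psi (half k y) * (psi (half k (x + y)))^-1) ^+ (2 ^ k))%g @[k --> U]
    --> (E x * E y * (E (x + y))^-1)%g.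
  rewrite (_ : (fun k => _) = (fun k => psi (half k x) ^+ (2 ^ k) * psi (half k y) ^+ (2 ^ k)
     * ((psi (half k (x + y))) ^+ (2 ^ k))^-1)%g).
    by apply: mulg_cvg; [apply: mulg_cvg|apply: invg_cvg].
  apply/funext => k; rewrite expgnFl; last exact: abD.
  by rewrite expgMn //; exact: abD.
apply: (lin_cvg1 lin hD lim) => s s0; apply: ooU.
have C1 : 0 < C + 1 by rewrite ltr_wpDl.
(* |x/2^k|, |y/2^k| <= t keeps their product in the chart, and |y/2^k| <= m / (2C|x| + 1)
   bounds the power 2^k of the error by 2m <= s *)
pose t := Num.min (r / 3) (C + 1)^-1.
have t0 : 0 < t by rewrite lt_min divr_gt0 ?(lin_r0 lin) //= invr_gt0.
have [tr tC] : t <= r / 3 /\ C * t <= 1.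
  split; first by rewrite ge_min lexx.
  apply: (@le_trans _ _ (C * (C + 1)^-1)).
    by rewrite ler_wpM2l // ge_min lexx orbT.
  rewrite ler_pdivrMr //; lra.
pose m := Num.min rho (s / 2).
have m0 : 0 < m by rewrite lt_min rho_gt0 divr_gt0.
have [mrho ms] : m <= rho /\ m <= s / 2 by split; rewrite ge_min lexx ?orbT.
have Cx0 : 0 <= 2 * C * `|x| by rewrite !mulr_ge0.
have Cx : 0 < 2 * C * `|x| + 1 by rewrite ltr_wpDl.
have m20 : 0 < m / (2 * C * `|x| + 1) by rewrite divr_gt0.
near=> k.
have hx : `|half k x| <= t by near: k; exact: half_small.
have hy : `|half k y| <= t by near: k; exact: half_small.
have hxy : `|half k (x + y)| <= r by near: k; apply: half_small; exact: lin_r0 lin.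
have hy2 : `|half k y| <= m / (2 * C * `|x| + 1) by near: k; exact: half_small.
have r0 := lin_r0 lin.
have [||w -> dw] := lin_mul lin (_ : `|half k x| <= r) (_ : `|half k y| <= r); [lra|lra|].
have hD' : half k x + half k y = half k (x + y) by rewrite /half scalerDr.
have Chx : C * `|half k x| <= 1 by apply: le_trans tC; rewrite ler_wpM2l.
have wr : `|w| <= r.
  rewrite -(subrK (half k x + half k y) w); apply: le_trans (ler_normD _ _) _.
  have := ler_normD (half k x) (half k y).
  have : C * `|half k x| * `|half k y| <= 1 * `|half k y| by rewrite ler_wpM2r.
  lra.
have [z -> dz] := lin_div lin wr hxy.
have zm : (2 ^ k)%N%:R * `|z| <= m.
  apply: (@le_trans _ _ ((2 ^ k)%N%:R * (2 * (C * `|half k x| * `|half k y|)))).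
    rewrite ler_wpM2l //; apply: le_trans dz _; rewrite ler_wpM2l //.
    by rewrite -hD'.
  rewrite (_ : _ * (2 * _) = 2 * C * ((2 ^ k)%N%:R * `|half k x|) * `|half k y|); last by ring.
  rewrite half_norm mulVKf ?gt_eqF //.
  apply: (@le_trans _ _ ((2 * C * `|x| + 1) * `|half k y|)).
    by rewrite ler_wpM2r // lerDl.
  by rewrite mulrC -ler_pdivlMr.
have [|y' -> dy'] := @expg_rho z (2 ^ k); first exact: le_trans mrho.
exists y' => //.
rewrite -(subrK ((2 ^ k)%N%:R *: z) y'); apply: le_trans (ler_normD _ _) _.
rewrite normrZ normr_nat.
have : C * ((2 ^ k)%N%:R * `|z|) * ((2 ^ k)%N%:R * `|z|) <= 1 * ((2 ^ k)%N%:R * `|z|).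
  rewrite ler_wpM2r ?mulr_ge0 //; apply: le_trans rho_C; rewrite ler_wpM2l //.
  exact: le_trans mrho.
rewrite -mulrA -expr2; lra.
Unshelve. all: by end_near. Qed.

End Exponential.

(** * The lattice of a torus *)

Definition one_param (R : realType) (G : topGroupType) (e : R -> G) : Prop :=
  continuous e /\ {morph e : s t / s + t >-> (s * t)%g}.

(** Linear independence over R in the space of one-parameter subgroups. *)
Definition independent (R : realType) (G : topGroupType) (e f : R -> G) : Prop :=
  forall s t, (forall u, (e (s * u)%R * f (t * u)%R)%g = 1%g) -> s = 0 /\ t = 0.

Lemma mulg_nbhs (G : topGroupType) (g : G) (W : set G) :
  nbhs 1%g W -> \forall h \near g, W (g^-1 * h)%g.
Proof.
move=> W1.
have c : (g^-1 * h)%g @[h --> g] --> (g^-1 * g)%g.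
  by apply: mulg_cvg; [exact: cvg_cst|exact: cvg_id].
by rewrite mulVg in c; exact: c.
Qed.

Section TorusLattice.
Variables (R : realType) (D : topGroupType) (n : nat).
Variables (psi : 'rV[R]_n -> D) (r C : R).
Hypothesis lin : linearizing psi r C.
Hypothesis hD : hausdorff_space D.
Hypothesis abD : forall x y : D, commute x y.
Variables (E : 'rV[R]_n -> D) (rho : R).
Hypothesis rho0 : 0 < rho.
Hypothesis ED : {morph E : x y / x + y >-> (x * y)%g}.
Hypothesis Epsi : forall x, `|x| <= rho ->
  exists2 y, E x = psi y & `|y - x| <= C * `|x| ^+ 2.

(* within delta of 0, E x = psi y with y off x by a quarter of its size at most *)
Let delta : R := Num.min rho (Num.min (r / 2) (4 * (C + 1))^-1).

Let C1 : 0 < C + 1. Proof. by rewrite ltr_wpDl ?(lin_C0 lin). Qed.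

Let delta_gt0 : 0 < delta.
Proof. by rewrite !lt_min rho0 divr_gt0 ?(lin_r0 lin) //= invr_gt0 mulr_gt0. Qed.

Let delta_rho : delta <= rho. Proof. by rewrite ge_min lexx. Qed.

Let delta_r : delta <= r / 2.
Proof. by rewrite /delta !ge_min lexx !orbT. Qed.

Let delta_C : C * delta <= 1 / 4.
Proof.
have C0 := lin_C0 lin.
apply: (@le_trans _ _ (C * (4 * (C + 1))^-1)).
  by rewrite ler_wpM2l // /delta !ge_min lexx !orbT.
rewrite ler_pdivrMr ?mulr_gt0 //; lra.
Qed.

Let E_near (x : 'rV[R]_n) : `|x| <= delta -> exists y, [/\ E x = psi y,
  `|y - x| <= `|x| / 4 & `|y| <= r].
Proof.
move=> xd; have [y -> dy] := Epsi (le_trans xd delta_rho).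
have : C * `|x| * `|x| <= 1 / 4 * `|x|.
  rewrite ler_wpM2r //; apply: le_trans delta_C; rewrite ler_wpM2l //.
  exact: lin_C0 lin.
rewrite -mulrA -expr2 => h.
exists y; split => //; first lra.
rewrite -(subrK x y); apply: le_trans (ler_normD _ _) _.
have := delta_r; have := normr_ge0 x; lra.
Qed.

Lemma exp_continuous : continuous E.
Proof.
apply: hom_continuous => //; rewrite /prop_for /continuous_at (hom0 ED) -(lin1 lin).
have l0 : `|0 : 'rV[R]_n| <= r by rewrite normr0 ltW // (lin_r0 lin).
move=> W /(lin_cont lin l0)/nbhs_ballP[s /= s0 sW].
have [m m0 [md ms]] : exists2 m, 0 < m & m <= delta /\ m < s / 2.
  exists (Num.min delta (s / 3)).
    by rewrite lt_min delta_gt0 divr_gt0.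
  split; first by rewrite ge_min lexx.
  by rewrite gt_min; apply/orP; right; lra.
apply/nbhs_ballP; exists m => //= x.
rewrite -ball_normE /ball_ /= sub0r normrN => /ltW xm.
have [y [-> dy yr]] := E_near (le_trans xm md).
apply: sW; rewrite -ball_normE /ball_ /= sub0r normrN.
rewrite -(subrK x y); apply: le_lt_trans (ler_normD _ _) _.
have := normr_ge0 x; lra.
Qed.

(** Near 0, E u is psi of a nonzero vector, and psi is injective there. *)
Lemma exp_line_neq1 (x : 'rV[R]_n) : (forall u : R, E (u *: x) = 1%g) -> x = 0.
Proof.
move=> H; apply/eqP/negPn/negP => x0.
have nx : 0 < `|x| by rewrite normr_gt0.
pose u := delta / `|x|.
have ux : `|u *: x| = delta.
  by rewrite normrZ ger0_norm ?divr_ge0 // ?ltW // /u divfK ?gt_eqF.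
have uxd : `|u *: x| <= delta by rewrite ux.
have [y [Ey dy yr]] := E_near uxd.
have l0 : `|0 : 'rV[R]_n| <= r by rewrite normr0 ltW // (lin_r0 lin).
have y0 : y = 0 by apply: (lin_inj lin) => //; rewrite -Ey H (lin1 lin).
by move: dy; rewrite y0 sub0r normrN ux; have := delta_gt0; lra.
Qed.

(** Successive approximation: psi y differs from E y by an element of half the
    size, so psi y is a limit of E (y + y1 + y2 + ...), and the image under E of a
    closed ball is closed. *)
Lemma exp_small_surj (y : 'rV[R]_n) : `|y| <= delta ->
  exists2 x, `|x| <= 2 * `|y| & psi y = E x.
Proof.
move=> yd.
have step k : exists s y' : 'rV[R]_n, [/\ `|s| <= 2 * `|y| - 2 * `|y| / (2 ^ k)%N%:R,
    `|y'| <= `|y| / (2 ^ k)%N%:R & psi y = (E s * psi y')%g].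
  elim: k => [|k [s [y' [hs hy' Ey]]]].
    exists 0, y; rewrite expn0 !divr1 subrr normr0; split => //.
    by rewrite (hom0 ED) mul1g.
  have k0 : 0 < (2 ^ k)%N%:R :> R by rewrite ltr0n expn_gt0.
  have k1 : 1 <= (2 ^ k)%N%:R :> R by rewrite ler1n expn_gt0.
  have y'd : `|y'| <= delta.
    apply: le_trans hy' _; apply: le_trans yd; rewrite ler_pdivrMr //.
    by rewrite ler_peMr.
  have y'r : `|y'| <= r by have := delta_r; have := lin_r0 lin; lra.
  have [y1 [Ey' dy1 y1r]] := E_near y'd.
  have [z' Ez' dz'] := lin_div lin y'r y1r.
  exists (s + y'), z'; rewrite expnS natrM; split.
  - apply: le_trans (ler_normD _ _) _.
    have E1 : 2 * `|y| / (2 * (2 ^ k)%N%:R) = `|y| / (2 ^ k)%N%:R by field; rewrite gt_eqF.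
    have E2 : 2 * `|y| / (2 ^ k)%N%:R = 2 * (`|y| / (2 ^ k)%N%:R) by rewrite mulrA.
    rewrite E1; rewrite E2 in hs; lra.
  - have E1 : `|y| / (2 * (2 ^ k)%N%:R) = (`|y| / (2 ^ k)%N%:R) / 2 by field; rewrite gt_eqF.
    rewrite distrC in dz'; rewrite E1; lra.
  - by rewrite Ey ED -mulgA -Ez' -Ey' (abD (E y')) mulgVK.
have cK : closed [set E x | x in [set x | `|x - 0| <= 2 * `|y|]].
  apply: compact_closed => //; apply: continuous_compact.
    exact/continuous_subspaceT/exp_continuous.
  exact: closed_ballrV_compact.
have /choice[s /choice[y' H]] := step.
have y'0 : y' k @[k --> \oo] --> (0 : 'rV[R]_n).
  apply/cvgrPdist_le => e e0.
  exists (Num.bound (`|y| / e)) => // k /= yk.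
  rewrite sub0r normrN; have [_ h _] := H k; apply: le_trans h _.
  rewrite ler_pdivrMr ?ltr0n ?expn_gt0 // mulrC -ler_pdivrMr //.
  apply: ltW; apply: lt_le_trans (archi_boundP _) _; first by rewrite divr_ge0 // ltW.
  by rewrite ler_nat; apply: leq_trans yk _; apply: ltnW; exact: ltn_expl.
have l0 : `|0 : 'rV[R]_n| <= r by rewrite normr0 ltW // (lin_r0 lin).
have lim : (psi y * (psi (y' k))^-1)%g @[k --> \oo] --> (psi y * 1^-1)%g.
  apply: mulg_cvg; first exact: cvg_cst.
  apply: invg_cvg; rewrite -(lin1 lin).
  by apply: cvg_comp y'0 _; exact: (lin_cont lin l0).
rewrite invg1 mulg1 in lim.
have [|x /= xy <-] := closed_cvg _ cK _ _ lim; last first.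
  by exists x => //; rewrite subr0 in xy.
apply: nearW => k; have [h _ ->] := H k.
exists (s k); last by rewrite mulgK.
rewrite /= subr0; apply: le_trans h _.
by rewrite gerBl divr_ge0 // mulr_ge0.
Qed.

Hypothesis cD : compact [set: D].
Hypothesis coD : connected [set: D].

Let near_exp : \forall g \near (1%g : D), exists2 x, `|x| <= 2 * delta & g = E x.
Proof.
apply: filterS (lin_near lin delta_gt0) => g [y yd ->].
have [x xy ->] := exp_small_surj yd.
exists x => //; apply: le_trans xy _; by rewrite ler_wpM2l.
Qed.

(** The image is a subgroup containing a neighbourhood of 1, so it is open and
    closed. *)
Lemma exp_surj (g : D) : exists x, g = E x.
Proof.
suff S : [set E x | x in [set: 'rV[R]_n]] = [set: D].
  have : [set: D] g by [].
  by rewrite -S => -[x _ <-]; exists x.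
apply: coD.
- by exists (E 0), 0.
- exists [set E x | x in [set: 'rV[R]_n]]; last by rewrite setTI.
  rewrite openE => _ [x _ <-]; apply: filterS (mulg_nbhs (E x) near_exp) => h [y _ Ey].
  by exists (x + y) => //; rewrite ED -Ey mulVKg.
- exists [set E x | x in [set: 'rV[R]_n]]; last by rewrite setTI.
  rewrite -[X in closed X]setCK; apply: open_closedC; rewrite openE => h nh.
  apply: filterS (mulg_nbhs h near_exp) => k [y _ Ey] [x _ Ex].
  apply: nh; exists (x - y) => //.
  by rewrite (homB ED) -Ey Ex invgM invgK mulgA mulgV mul1g.
Qed.

(** Otherwise some g_N lies outside the image of the ball of radius N for every
    N; the g_N accumulate at some E x, and E maps a fixed ball around x onto a
    neighbourhood of E x. *)
Lemma exp_cocompact : exists N : R, forall x, exists2 b, `|b| <= N & E x = E b.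
Proof.
apply/not_existsP => H.
have /choice[x Hx] : forall N : nat, exists x, forall b, `|b| <= N%:R -> E x <> E b.
  move=> N; have := H N%:R; rewrite -existsNE => -[x Hx]; exists x => b bN Eb.
  by apply: Hx; exists b.
have [g [_ cg]] := @cD (E (x k) @[k --> \oo])%classic (fmap_proper_filter _ _) filterT.
have [a ga] := exp_surj g.
have [|z [[k ak <-] [y yd Ey]]] := cg [set E (x k) | k in [set k | `|a| + 2 * delta <= k%:R]] _ _ (mulg_nbhs g near_exp).
  exists (Num.bound (`|a| + 2 * delta)) => // k /= hk; exists k => //=.
  apply: ltW; apply: lt_le_trans (archi_boundP _) _; last by rewrite ler_nat.
  by rewrite addr_ge0 // mulr_ge0 // ltW.
apply: (Hx k (a + y)).
  by apply: le_trans ak; apply: le_trans (ler_normD _ _) _; rewrite lerD2l.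
by rewrite ED -Ey -ga mulVKg.
Qed.

End TorusLattice.

(** The kernel of the exponential map meets every ball of a fixed radius N, so
    it contains points close to large multiples of two distinct coordinate
    vectors; these are linearly independent. *)
Lemma torus_circles (R : realType) (D : topGroupType) (d : nat) :
  torus R D d -> (2 <= d)%N -> exists e f : R -> D,
  [/\ one_param e, one_param f, e 1 = 1%g, f 1 = 1%g & independent e f].
Proof.
move=> [[hD lieD] cD coD abD] d2.
have [psi [r [C lin]]] := lie_group_linearizing (conj hD lieD).
have [E [rho [rho0 ED Epsi]]] := compact_abelian_exp lin hD cD abD.
have [N HN] := exp_cocompact lin hD abD rho0 ED Epsi cD coD.
have Ec := exp_continuous lin rho0 ED Epsi.
pose i0 := Ordinal (ltnW d2); pose i1 := Ordinal d2.
pose T := 2 * `|N| + 1.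
have lattice i : exists g : 'rV[R]_d, E g = 1%g /\ `|g - T *: delta_mx 0 i| <= `|N|.
  have [b bN Eb] := HN (T *: delta_mx 0 i).
  exists (T *: delta_mx 0 i - b); rewrite (homB ED) Eb mulgV; split => //.
  rewrite addrC addKr normrN; apply: le_trans bN _; exact: ler_norm.
have [g0 [Eg0 hg0]] := lattice i0.
have [g1 [Eg1 hg1]] := lattice i1.
have circ g : E g = 1%g -> one_param (fun t => E (t *: g)) /\ E (1 *: g) = 1%g.
  move=> Eg; rewrite scale1r; split => //; split.
    move=> t; apply: (@cvg_comp _ _ _ (fun t => t *: g) E); last exact: Ec.
    by apply: cvgZr_tmp; exact: cvg_id.
  by move=> s t; rewrite scalerDl ED.
exists (fun t => E (t *: g0)), (fun t => E (t *: g1)).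
have [c0 e0] := circ _ Eg0; have [c1 e1] := circ _ Eg1.
split => // s t H.
have st0 : s *: g0 + t *: g1 = 0.
  apply: (exp_line_neq1 lin rho0 Epsi) => u.
  by rewrite scalerDr ED !scalerA [u * s]mulrC [u * t]mulrC H.
(* if |b| <= |a|, the i-th coordinate of a g + b h is at least |a| (T - 2N) in size *)
have key i j (g h : 'rV[R]_d) (a b : R) : i != j -> `|g - T *: delta_mx 0 i| <= `|N| ->
   `|h - T *: delta_mx 0 j| <= `|N| -> a *: g + b *: h = 0 -> `|b| <= `|a| -> a = 0.
  move=> ij hg hh ab ba; apply/eqP; rewrite -normr_le0.
  have /rowP/(_ i) := ab; rewrite !mxE => E0.
  have := le_trans (rV_coord_le _ i) hg; rewrite !mxE !eqxx /= mulr1 => gi.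
  have := le_trans (rV_coord_le _ i) hh; rewrite !mxE (negPf ij) /= mulr0 subr0 => hi.
  have E1 : a * T = - (a * (g 0 i - T)) - b * h 0 i by rewrite -[RHS]addr0 -E0; ring.
  have : `|a| * T <= `|a| * `|N| + `|a| * `|N|.
    have T0 : 0 <= T by rewrite /T addr_ge0 // mulr_ge0.
    rewrite -{1}(ger0_norm T0) -normrM E1; apply: le_trans (ler_normB _ _) _.
    rewrite normrN !normrM lerD // ?ler_wpM2l //.
    by apply: ler_pM.
  rewrite /T; lra.
have [st|/ltW st] := leP `|t| `|s|.
  have s0 : s = 0 by apply: (key i0 i1 g0 g1 s t).
  by split => //; apply/eqP; rewrite -normr_le0; rewrite s0 normr0 in st.
have t0 : t = 0 by apply: (key i1 i0 g1 g0 t s) => //; rewrite addrC.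
by split => //; apply/eqP; rewrite -normr_le0; rewrite t0 normr0 in st.
Qed.

(** * Dimension bound *)

(** Cut the cube [-B, B]^n into (M+1)^n cells of side 2B/M. *)
Lemma bounded_pigeonhole (R : realType) (n : nat) (I : finType) (x : I -> 'rV[R]_n)
    (B : R) (M : nat) : 0 < B -> (0 < M)%N -> (forall i, `|x i| <= B) ->
  (M.+1 ^ n < #|I|)%N -> exists i j, i != j /\ `|x i - x j| <= 2 * B / M%:R.
Proof.
move=> B0 M0 xB card; apply: contrapT => H.
have M0' : 0 < M%:R :> R by rewrite ltr0n.
pose y i k : R := (x i 0 k + B) * M%:R / (2 * B).
have B20 : 0 < 2 * B by rewrite mulr_gt0.
have yM i k : 0 <= y i k <= M%:R.
  have := le_trans (rV_coord_le (x i) k) (xB i); rewrite ler_norml => /andP[h1 h2].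
  rewrite /y; apply/andP; split.
    by apply: divr_ge0; [apply: mulr_ge0 => //; lra|exact: ltW].
  rewrite ler_pdivrMr // mulrC ler_wpM2l //; lra.
have cellP i k : (Num.truncn (y i k) < M.+1)%N.
  have /andP[y0 yM'] := yM i k.
  rewrite ltnS -(ler_nat R); apply: le_trans yM'.
  by have /andP[] := truncn_itv y0.
pose cell i : {ffun 'I_n -> 'I_M.+1} := [ffun k => Ordinal (cellP i k)].
have inj : injective cell.
  move=> i j ij; apply/eqP/negPn/negP => nij; apply: H; exists i, j; split => //.
  apply: rV_norm_le => [|k]; first by rewrite divr_ge0 // ltW.
  have /(congr1 val) /= E : cell i k = cell j k by rewrite ij.
  rewrite !ffunE /= in E.
  have /andP[yi0 _] := yM i k; have /andP[yj0 _] := yM j k.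
  have /andP[a1 a2] := truncn_itv yi0; have /andP[b1 b2] := truncn_itv yj0.
  rewrite -E in b1 b2.
  rewrite -natr1 in a2 b2.
  have yij : `|y i k - y j k| <= 1 by rewrite ler_norml; lra.
  rewrite !mxE.
  have -> : x i 0 k - x j 0 k = (y i k - y j k) * (2 * B / M%:R).
    by rewrite /y; field; rewrite !gt_eqF.
  have Q0 : 0 <= 2 * B / M%:R by rewrite divr_ge0 // ltW.
  by rewrite normrM -[leRHS]mul1r (ger0_norm Q0) ler_wpM2r.
have := leq_card cell inj.
by rewrite card_ffun !card_ord leqNgt card.
Qed.

Lemma set1_closed (G : topGroupType) : hausdorff_space G -> closed [set (1%g : G)].
Proof.
by move=> hG; apply: accessible_closed_set1; exact: hausdorff_accessible.
Qed.

Section Packing.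
Variables (R : realType) (G : topGroupType) (n : nat).
Variables (psi : 'rV[R]_n -> G) (r C : R).
Hypothesis lin : linearizing psi r C.
Hypothesis hG : hausdorff_space G.
Variables (k : nat) (th : 'rV[R]_k -> G).
Hypothesis thc : continuous th.
Hypothesis thD : {morph th : x y / x + y >-> (x * y)%g}.
Hypothesis big_k : (2 * 3 ^ n <= 2 ^ k)%N.

(** Were th injective near 0, the 2^(jk) points of a grid of mesh 2^-j would be
    sent to points whose mutual distances are at least a constant times 3^-j: the
    difference of two of them, after at most j doublings, each multiplying the
    coordinates by at most 3, reaches a fixed shell on which th stays away from 1.
    But a ball of R^n has room for only O(3^(jn)) such points. *)
Lemma packing : forall delta : R, 0 < delta ->
  exists2 x, 0 < `|x| <= delta & th x = 1%g.
Proof.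
move=> delta delta0; apply: contrapT => H.
have th0 := hom0 thD.
have r0 := lin_r0 lin; have C0 := lin_C0 lin.
have C1 : 0 < C + 1 by rewrite ltr_wpDl.
pose r1 := Num.min r (C + 1)^-1.
have r10 : 0 < r1 by rewrite lt_min r0 invr_gt0.
have r1r : r1 <= r by rewrite ge_min lexx.
have r1C : C * r1 <= 1.
  apply: (@le_trans _ _ (C * (C + 1)^-1)).
    by rewrite ler_wpM2l // ge_min lexx orbT.
  rewrite ler_pdivrMr //; lra.
have [rho [rho0 rhod thr1]] : exists rho : R, [/\ 0 < rho, rho <= delta &
    forall x, `|x| <= rho -> exists2 y, `|y| <= r1 & th x = psi y].
  have := @thc 0; rewrite /continuous_at th0 => /(_ _ (lin_near lin r10)).
  move=> /nbhs_ballP[s /= s0 hs].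
  exists (Num.min (s / 2) delta); split; first by rewrite lt_min delta0 divr_gt0.
    by rewrite ge_min lexx orbT.
  move=> x xs; apply: hs; rewrite -ball_normE /ball_ /= sub0r normrN.
  apply: le_lt_trans xs _; rewrite gt_min; apply/orP; left; lra.
pose S : set 'rV[R]_k := [set x | `|x - 0| <= rho] `&` [set x | rho / 2 <= `|x|].
have cS : closed [set th x | x in S].
  apply: compact_closed => //; apply: continuous_compact.
    exact/continuous_subspaceT.
  apply: compact_closedI; first exact: closed_ballrV_compact.
  apply: (@closed_comp _ _ (fun x : 'rV[R]_k => `|x|) [set a : R | rho / 2 <= a]).
    by move=> x _; exact: norm_continuous.
  exact: closed_ge.
have [c [c0 cr1 cS']] : exists c : R, [/\ 0 < c, c <= r1 &
    forall v, `|v| <= c -> ~ [set th x | x in S] (psi v)].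
  have n1 : nbhs (psi 0) (~` [set th x | x in S]).
    apply: open_nbhs_nbhs; split; first exact: closed_openC.
    move=> [x [/= xr xr2]]; rewrite (lin1 lin) => thx.
    apply: H; exists x => //; apply/andP; split.
      by apply: lt_le_trans xr2; rewrite divr_gt0.
    by rewrite subr0 in xr; apply: le_trans rhod.
  have l0 : `|0 : 'rV[R]_n| <= r by rewrite normr0 ltW.
  have /nbhs_ballP[s /= s0 hs] := lin_cont lin l0 n1.
  exists (Num.min (s / 2) r1); split; first by rewrite lt_min r10 divr_gt0.
    by rewrite ge_min lexx orbT.
  move=> x xs; apply: hs; rewrite -ball_normE /ball_ /= sub0r normrN.
  apply: le_lt_trans xs _; rewrite gt_min; apply/orP; left; lra.
(* the mesh 2 r1 / M in R^n is so fine that even 3^j times its double stays below c *)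
pose K := (Num.bound (4 * r1 / c)).+1.
have Kc : 4 * r1 <= K%:R * c.
  rewrite -ler_pdivrMr //; apply: ltW; apply: lt_trans (archi_boundP _) _.
    by apply: divr_ge0; [apply: mulr_ge0 => //|]; exact: ltW.
  by rewrite ltr_nat.
pose j := ((2 * K) ^ n)%N.
pose M := (3 ^ j * K)%N.
have M0 : (0 < M)%N by rewrite muln_gt0 expn_gt0.
have pow2 i : 0 < ((2 ^ i)%N%:R : R) by rewrite ltr0n expn_gt0.
pose pt (a : {ffun 'I_k -> 'I_(2 ^ j)}) : 'rV[R]_k :=
  (rho / (2 ^ j)%N%:R) *: \row_i (a i)%:R.
have pt_rho a b : `|pt a - pt b| <= rho.
  rewrite /pt -scalerBr normrZ ger0_norm; last by rewrite divr_ge0 // ltW.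
  rewrite mulrAC ler_pdivrMr // ler_wpM2l //; first exact: ltW.
  apply: rV_norm_le => // i; rewrite !mxE ler_norml.
  have ha : (a i)%:R <= (2 ^ j)%N%:R :> R by rewrite ler_nat ltnW.
  have hb : (b i)%:R <= (2 ^ j)%N%:R :> R by rewrite ler_nat ltnW.
  have : 0 <= (a i)%:R :> R by []. 
  have : 0 <= (b i)%:R :> R by [].
  lra.
have pt0 a : `|pt a| <= rho.
  have Z : (0 < 2 ^ j)%N by rewrite expn_gt0.
  have := pt_rho a [ffun=> Ordinal Z].
  rewrite {2}/pt (_ : (\row_i _) = 0) ?scaler0 ?subr0 //.
  by apply/rowP => i; rewrite !mxE ffunE.
have /choice[v Hv] : forall a, exists y, `|y| <= r1 /\ th (pt a) = psi y.
  by move=> a; have [y y1 y2] := thr1 _ (pt0 a); exists y.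
have [||a [b [ab vab]]] := @bounded_pigeonhole R n _ v r1 M r10 M0.
- by move=> a; case: (Hv a).
- rewrite card_ffun !card_ord -expnM mulnC expnM.
  apply: (@leq_ltn_trans ((3 ^ j * (2 * K)) ^ n)).
    have [->|n0] := posnP n; first by rewrite !expn0.
    rewrite leq_exp2r // mulnCA -/M mul2n -addnn -addn1 leq_add2l //.
  have big : ((2 * 3 ^ n) ^ j <= (2 ^ k) ^ j)%N.
    by rewrite leq_exp2r // /j expn_gt0.
  apply: leq_trans big; rewrite !expnMn -expnM (mulnC j n) expnM mulnC -expnMn -/j.
  by rewrite ltn_pmul2r ?expn_gt0 // ltn_expl.
have := Hv a; have := Hv b => -[vb Eb] [va Ea].
have [z Ez dz] := lin_div lin (le_trans va r1r) (le_trans vb r1r).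
pose w := pt a - pt b.
have thw : th w = psi z by rewrite (homB thD) Ea Eb Ez.
have w_ge : rho <= (2 ^ j)%N%:R * `|w|.
  have [i abi] : exists i, a i != b i.
    by apply/existsP; rewrite -negb_forall; apply: contra ab => /forallP E;
       apply/eqP/ffunP => i; exact/eqP.
  have n1 : 1 <= `|(a i)%:R - (b i)%:R : R|.
    move: abi; rewrite -val_eqE /= neq_ltn => /orP[]; rewrite -(ler_nat R) -natr1 => h;
      rewrite ler_normr; apply/orP; [right|left]; lra.
  rewrite -ler_pdivrMl // mulrC; apply: le_trans (rV_coord_le w i).
  have Q0 : 0 <= rho / (2 ^ j)%N%:R by rewrite divr_ge0 // ltW.
  by rewrite /w /pt -scalerBr !mxE normrM (ger0_norm Q0) ler_peMr.
have pow3 i : 0 < ((3 ^ i)%N%:R : R) by rewrite ltr0n expn_gt0.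
have aux (x a' b' : R) : 0 < a' -> 0 < b' -> 2 * (2 * x / (a' * b')) * a' = 4 * x / b'.
  by move=> a0 b0; field; rewrite !gt_eqF.
have zM : `|z| <= c / (3 ^ j)%N%:R.
  apply: le_trans dz _; apply: (@le_trans _ _ (2 * (2 * r1 / M%:R))).
    by rewrite ler_wpM2l.
  rewrite /M natrM ler_pdivlMr // (_ : 2 * (2 * r1 / _) * _ = 4 * r1 / K%:R).
    by rewrite ler_pdivrMr ?ltr0n // [leRHS]mulrC.
  exact: (aux r1 _ _ (pow3 j) (_ : 0 < K%:R)).
have dbl i : (i <= j)%N -> exists2 z', th ((2 ^ i)%N%:R *: w) = psi z' &
    `|z'| <= (3 ^ i)%N%:R * `|z|.
  elim: i => [_|i IH ij]; first by exists z; rewrite ?expn0 ?scale1r ?mul1r.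
  have [y Ey dy] := IH (ltnW ij).
  have yr1 : `|y| <= r1.
    apply: le_trans dy _; apply: (@le_trans _ _ ((3 ^ i)%N%:R * (c / (3 ^ j)%N%:R))).
      by rewrite ler_wpM2l.
    apply: le_trans cr1; rewrite mulrA ler_pdivrMr // mulrC ler_wpM2l //.
      exact: ltW.
    by rewrite ler_nat leq_exp2l // ltnW.
  have yr := le_trans yr1 r1r.
  have [y' Ey' dy'] := lin_mul lin yr yr.
  exists y'.
    by rewrite expnS natrM -scalerA (scaler_nat 2) mulr2n thD Ey Ey'.
  have Cy : C * `|y| * `|y| <= 1 * `|y|.
    by rewrite ler_wpM2r //; apply: le_trans r1C; rewrite ler_wpM2l.
  rewrite expnS natrM -mulrA; apply: (@le_trans _ _ (3 * `|y|)); last by rewrite ler_wpM2l.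
  rewrite -(subrK (y + y) y'); apply: le_trans (ler_normD _ _) _.
  have := ler_normD y y; lra.
have ex_i : exists i, rho / 2 < (2 ^ i)%N%:R * `|w|.
  exists j; apply: lt_le_trans w_ge; lra.
case: (ex_minnP ex_i) => i hi imin.
have ij : (i <= j)%N by apply: imin; apply: lt_le_trans w_ge; lra.
have iw : (2 ^ i)%N%:R * `|w| <= rho.
  case: i hi imin {ij} => [|i] hi imin; first by rewrite expn0 mul1r pt_rho.
  have : ~~ (rho / 2 < (2 ^ i)%N%:R * `|w|).
    by apply/negP => /imin; rewrite ltnn.
  rewrite -leNgt expnS natrM; lra.
have [z' Ez' dz'] := dbl i ij.
apply: (cS' z').
  apply: le_trans dz' _; apply: (@le_trans _ _ ((3 ^ j)%N%:R * (c / (3 ^ j)%N%:R))).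
    apply: ler_pM => //; by rewrite ler_nat leq_exp2l.
  by rewrite mulrC divfK // gt_eqF.
exists ((2 ^ i)%N%:R *: w) => //; split => /=.
  by rewrite subr0 normrZ normr_nat.
by rewrite normrZ normr_nat ltW.
Qed.
End Packing.

(** * Kernels of homomorphisms from vector spaces *)

(** Directions of smaller and smaller elements of a closed subgroup K accumulate
    at a direction v, and the line Rv is a limit of the subgroups Z x with x in K
    small and nearly parallel to v. *)
Lemma kernel_line (R : realType) (G : topGroupType) (k : nat) (th : 'rV[R]_k -> G) :
  hausdorff_space G -> continuous th -> {morph th : x y / x + y >-> (x * y)%g} ->
  (forall delta : R, 0 < delta -> exists2 x, 0 < `|x| <= delta & th x = 1%g) ->
  exists2 v, v != 0 & forall t : R, th (t *: v) = 1%g.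
Proof.
move=> hG thc thD small.
have /choice[x Hx] : forall N : nat, exists x, 0 < `|x| <= N.+1%:R^-1 /\ th x = 1%g.
  by move=> N; have [|x h1 h2] := small N.+1%:R^-1; [rewrite invr_gt0|exists x].
have x0 N : 0 < `|x N| by case: (Hx N) => /andP[].
pose u N := `|x N|^-1 *: x N.
have u1 N : `|u N| = 1.
  by rewrite normrZ ger0_norm ?invr_ge0 // mulVf // gt_eqF.
have [|v [_ cv]] := @closed_ballrV_compact R k 0 1 (u N @[N --> \oo])%classic (fmap_proper_filter _ _).
  by exists 0%N => // N _ /=; rewrite subr0 u1.
have approx (e : R) : 0 < e -> exists N, `|v - u N| < e /\ `|x N| <= e.
  move=> e0.
  have [|_ [[N eN <-] ve]] := cv [set u N | N in [set N | e^-1 <= N%:R]] _ _ (nbhsx_ballx v e e0).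
    exists (Num.bound e^-1) => // N /= hN; exists N => //=.
    apply: ltW; apply: lt_le_trans (archi_boundP _) _; last by rewrite ler_nat.
    by rewrite invr_ge0 ltW.
  exists N; split; first by move: ve; rewrite -ball_normE.
  case: (Hx N) => /andP[_ h] _; apply: le_trans h _.
  rewrite invf_ple ?posrE // /= in eN *; apply: le_trans eN _.
  by rewrite ler_nat.
exists v.
  apply/eqP => v0; have [|N []] := approx (1 / 2); first by rewrite divr_gt0.
  by rewrite v0 sub0r normrN u1; lra.
have pos t : 0 <= t -> th (t *: v) = 1%g.
  move=> t0.
  have cl : closed (th @^-1` [set 1%g]).
    by apply: closed_comp; [move=> y _; exact: thc|exact: set1_closed].
  suff : closure (th @^-1` [set 1%g]) (t *: v).
    by rewrite -((closure_id _).1 cl).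
  move=> B /nbhs_ballP[e /= e0 eB].
  have t1 : 0 < t + 1 by rewrite ltr_wpDl.
  have [|N [vu xe]] := approx (e / (2 * (t + 1))); first by rewrite divr_gt0 // mulr_gt0.
  have xN0 := x0 N.
  pose n := Num.truncn (t / `|x N|).
  have /andP[n1 n2] := truncn_itv (divr_ge0 t0 (ltW xN0)).
  rewrite -/n ler_pdivlMr // in n1; rewrite -/n ltr_pdivrMr // -natr1 in n2.
  exists (x N *+ n); split.
    by rewrite /= (homMn thD); case: (Hx N) => _ ->; rewrite expg1n.
  apply: eB; rewrite -ball_normE /ball_ /=.
  have -> : t *: v - x N *+ n = t *: (v - u N) + (t - n%:R * `|x N|) *: u N.
    have -> : x N *+ n = (n%:R * `|x N|) *: u N.
      by rewrite /u scalerA mulfK ?gt_eqF // scaler_nat.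
    by apply/rowP => i; rewrite !mxE; ring.
  apply: le_lt_trans (ler_normD _ _) _; rewrite (normrZ t) (normrZ (t - _) (u N)) u1 mulr1 (ger0_norm t0).
  rewrite (@ger0_norm _ (t - _)); last by lra.
  have a1 : t * `|v - u N| <= t * (e / (2 * (t + 1))) by rewrite ler_wpM2l // ltW.
  have a2 : (t + 1) * (e / (2 * (t + 1))) = e / 2 by field; rewrite gt_eqF.
  have a3 : 0 < e / (2 * (t + 1)) by rewrite divr_gt0 // mulr_gt0.
  lra.
move=> t; have [/pos//|/ltW t0] := leP 0 t.
by rewrite -[t]opprK scaleNr (homN thD) pos ?oppr_ge0 // invg1.
Qed.

Definition central_param (R : realType) (G : topGroupType) (e : R -> G) : Prop :=
  one_param e /\ forall t, centerg G (e t).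

Lemma commute_morph (R : realType) (G : topGroupType) (e f : R -> G) :
  central_param e -> one_param f ->
  {morph (fun x : 'rV[R]_2 => e (x 0 0) * f (x 0 1%R))%g : x y / x + y >-> (x * y)%g}.
Proof.
move=> [[_ eD] eC] [_ fD] x y; rewrite !mxE eD fD -!mulgA; congr (_ * _)%g.
by rewrite !mulgA; congr (_ * _)%g; exact: eC.
Qed.

Lemma pair_continuous (R : realType) (G : topGroupType) (e f : R -> G) :
  one_param e -> one_param f ->
  continuous (fun x : 'rV[R]_2 => e (x 0 0) * f (x 0 1%R))%g.
Proof.
move=> [ec _] [fc _] x.
have cc (g : R -> G) (j : 'I_2) : continuous g ->
    (fun y : 'rV[R]_2 => g (y 0 j)) y @[y --> x] --> g (x 0 j).
  move=> gc.
  have h : (fun y : 'rV[R]_2 => y 0 j) y @[y --> x] --> x 0 j by exact: coord_continuous.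
  by apply: cvg_comp h _; exact: gc.
exact: mulg_cvg (cc e 0 ec) (cc f 1 fc).
Qed.

(** If f(1/N) = w(s_N) with 0 <= s_N < 1, the kernel of (s, t) |-> f(s)w(t)
    contains the bounded sequence of distinct points (1/N, -s_N), hence
    arbitrarily small nonzero vectors, hence a line. *)
Lemma range_sub_dependent (R : realType) (G : topGroupType) (f w : R -> G) :
  hausdorff_space G -> central_param f -> one_param w -> w 1 = 1%g ->
  range f `<=` range w -> ~ independent f w.
Proof.
move=> hG fp wp w1 fw ind.
have [[_ fD] _] := fp; have [_ wD] := wp.
have [|v v0 Hv] := kernel_line hG (pair_continuous fp.1 wp) (commute_morph fp wp).
  move=> delta d0.
  have /choice[s Hs] : forall N : nat, exists s, 0 <= s <= 1 /\ f N.+1%:R^-1 = w s.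
    move=> N; have [a _ Ha] := fw _ (ex_intro2 _ _ N.+1%:R^-1 I erefl).
    exists (a - (Num.floor a)%:~R).
    by split; [exact: frac_itv|rewrite -param_frac].
  pose M := (Num.bound (2 / delta)).+1.
  have M0 : 0 < M%:R :> R by rewrite ltr0n.
  pose p (i : 'I_((M.+1 ^ 2).+1)) : 'rV[R]_2 := \row_j (if j == 0 then (i.+1%:R)^-1 else - s i).
  have [||i [j [ij pij]]] := @bounded_pigeonhole R 2 _ p 1 M ltr01 isT.
  - move=> i; apply: rV_norm_le => // k; rewrite !mxE; case: ifP => _.
      by rewrite ger0_norm ?invr_ge0 // invf_ple ?posrE // invr1 ler1n.
    by have [/andP[h1 h2] _] := Hs i; rewrite normrN ger0_norm.
  - by rewrite card_ord.
  exists (p i - p j).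
    apply/andP; split.
      rewrite normr_gt0 subr_eq0; apply: contra ij => /eqP/rowP/(_ 0).
      rewrite !mxE /= => /invr_inj/eqP; rewrite eqr_nat eqSS => /eqP ij.
      exact/eqP/val_inj.
    apply: le_trans pij _; rewrite mulr1 ler_pdivrMr // mulrC -ler_pdivrMr //.
    apply: ltW; apply: lt_trans (archi_boundP _) _; first by rewrite divr_ge0 // ltW.
    by rewrite ltr_nat.
  have E m : (f (p m 0 0) * w (p m 0 1%R))%g = 1%g.
    by rewrite !mxE /=; have [_ ->] := Hs m; rewrite -wD subrr (hom0 wD).
  have := homB (commute_morph fp wp) (p i) (p j); rewrite /= => ->.
  by rewrite !E mulgV.
have [|h0 h1] := ind (v 0 0) (v 0 1).
  by move=> u; have := Hv u; rewrite !mxE ![u * _]mulrC.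
move/eqP: v0; apply; apply/rowP => i; rewrite mxE.
by case: i => -[|[|//]] hi; [rewrite -[RHS]h0|rewrite -[RHS]h1]; congr (v 0 _); apply: val_inj.
Qed.

(** Both e and f are proportional to w by the previous lemma, and w is
    nontrivial because e is. *)
Lemma range_sub_circle_dependent (R : realType) (G : topGroupType) (e f w : R -> G) :
  hausdorff_space G -> central_param e -> central_param f -> central_param w ->
  w 1 = 1%g -> range e `<=` range w -> range f `<=` range w -> ~ independent e f.
Proof.
move=> hG ep fp wp w1 ew fw ind.
have dep g : central_param g -> range g `<=` range w -> exists s t,
    (s != 0 \/ t != 0) /\ forall u, (g (s * u)%R * w (t * u)%R)%g = 1%g.
  move=> gp gw; apply: contrapT => H.
  apply: (range_sub_dependent hG gp wp.1 w1 gw) => s t Hst.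
  have [->|s0] := eqVneq s 0; have [->|t0] := eqVneq t 0 => //; exfalso; apply: H;
    exists s, t; (split; [|exact: Hst]); by [left|right].
have e1 : e 0 = 1%g := hom0 ep.1.2.
have f1 : f 0 = 1%g := hom0 fp.1.2.
have w0 : w 0 = 1%g := hom0 wp.1.2.
have [s [t [st Hst]]] := dep e ep ew.
have [s' [t' [st' Hst']]] := dep f fp fw.
have [t0|t0] := eqVneq t 0.
  rewrite t0 eqxx in st Hst; case: st => // s0.
  have [|s00 _] := ind s 0; last by rewrite s00 eqxx in s0.
  by move=> u; have := Hst u; rewrite !mul0r w0 f1.
have [t'0|t'0] := eqVneq t' 0.
  rewrite t'0 eqxx in st' Hst'; case: st' => // s0.
  have [|_ s00] := ind 0 s'; last by rewrite s00 eqxx in s0.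
  by move=> u; have := Hst' u; rewrite !mul0r w0 e1 mul1g mulg1.
have [|a b] := ind (s * t') (- (s' * t)).
  move=> u; have := Hst (t' * u); have := Hst' (t * u).
  rewrite !mulrA [t' * t]mulrC => h1 h2.
  rewrite mulNr (homN fp.1.2).
  have -> : e (s * t' * u) = f (s' * t * u).
    by apply: (@mulIg _ (w (t * t' * u)%R)); rewrite h2 h1.
  by rewrite mulgV.
have s0 : s = 0 by move/eqP: a; rewrite mulf_eq0 (negPf t'0) orbF => /eqP.
have wu u : w u = 1%g.
  have := Hst (u / t); rewrite s0 mul0r e1 mul1g mulrCA divff // mulr1.
  by [].
have [|/eqP] := ind 1 0; last by rewrite oner_eq0.
move=> u; rewrite mul0r f1 mulg1 mul1r.
by have [x _ <-] := ew _ (ex_intro2 _ _ u I erefl); exact: wu.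
Qed.

(** * Resolvents of polynomials *)

Section Resolvent.
Variable R : realType.
Implicit Types P Q : {poly R}.

(* the value at a of the polynomial with coefficients |P_i| *)
Let sizeA P (a : R) := \sum_(i < size P) `|P`_i| * a ^+ i.

Let sizeAE P a m : (size P <= m)%N -> sizeA P a = \sum_(i < m) `|P`_i| * a ^+ i.
Proof.
move=> Pm; rewrite /sizeA (big_ord_widen m (fun i => `|P`_i| * a ^+ i)) // big_mkcond.
apply: eq_bigr => i _; case: ltnP => // Pi.
by rewrite nth_default // normr0 mul0r.
Qed.

Let sizeAMXC P c a : sizeA (P * 'X + c%:P) a = sizeA P a * a + `|c|.
Proof.
rewrite (@sizeAE _ a (size P).+1); last first.
  by rewrite size_MXaddC; case: ifP.
rewrite big_ord_recl coefD coefMX coefC /= add0r expr0 mulr1 addrC; congr (_ + _).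
rewrite /sizeA mulr_suml; apply: eq_bigr => i _.
by rewrite coefD coefMX coefC /= addr0 exprSr mulrA.
Qed.

Let horner_sizeA P a : 0 <= a -> `|P.[a]| <= sizeA P a.
Proof.
move=> a0; rewrite horner_coef; apply: le_trans (ler_norm_sum _ _ _) _.
by apply: ler_sum => i _; rewrite normrM [`|a ^+ _|]ger0_norm // exprn_ge0.
Qed.

(** (P(a) - P) / (a - X), the quotient given by the factor theorem. *)
Lemma synthetic_division P (a : R) : 1 <= a -> exists Q,
  [/\ (a%:P - 'X) * Q = P.[a]%:P - P, (size Q <= size P)%N,
      P \is a polyOver Num.int_num_subdef -> a \is a Num.int -> Q \is a polyOver Num.int_num_subdef &
      forall i, `|Q`_i| * a <= sizeA P a].
Proof.
move=> a1; have a0 : 0 <= a by apply: le_trans a1.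
elim/poly_ind: P => [|P c [Q [QE Qs Qint Qb]]].
  exists 0; rewrite horner0 mulr0 subrr; split => //.
  by move=> i; rewrite coef0 normr0 mul0r /sizeA size_poly0 big_ord0.
exists (Q * 'X + P.[a]%:P); split.
- rewrite mulrDr mulrA QE hornerMXaddC polyCD polyCM; ring.
- rewrite !size_MXaddC; case: ifP => // Q0.
  case: ifP => [/andP[/eqP P0 _]|_]; last by rewrite ltnS.
  move: Qs Q0; rewrite P0 size_poly0 leqn0 size_poly_eq0 => /eqP ->.
  by rewrite horner0 !eqxx.
- move=> Pint aint.
  have P1int : P \is a polyOver Num.int_num_subdef.
    apply/polyOverP => i; have /polyOverP/(_ i.+1) := Pint.
    by rewrite coefD coefMX coefC /= addr0.
  rewrite rpredD ?rpredM ?polyOverX ?Qint // polyOverC.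
  exact: rpred_horner.
- move=> [|i]; rewrite sizeAMXC coefD coefMX coefC /= ?add0r ?addr0.
    by apply: (@le_trans _ _ (sizeA P a * a)); rewrite ?lerDl // ler_wpM2r // horner_sizeA.
  apply: le_trans (Qb i) _; apply: ler_wpDr => //.
  rewrite ler_peMr //; apply: sumr_ge0 => j _.
  by rewrite mulr_ge0 // exprn_ge0.
Qed.

(** For large a the leading term dominates, so that the sum of the |P_i| a^i,
    which bounds a |Q_i|, is at most 3 |P(a)|. *)
Lemma resolvent_small P : P != 0 -> exists a0 : R, forall a, a0 <= a -> exists Q,
  [/\ P.[a] != 0, (a%:P - 'X) * Q = P.[a]%:P - P, (size Q <= size P)%N,
      P \is a polyOver Num.int_num_subdef -> a \is a Num.int -> Q \is a polyOver Num.int_num_subdef &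
      forall i, `|P.[a]^-1 * Q`_i| <= 3 / a].
Proof.
move=> P0.
have sP : size P = (size P).-1.+1 by rewrite prednK // size_poly_gt0.
set m := (size P).-1 in sP.
pose S := \sum_(i < m) `|P`_i|.
have S0 : 0 <= S by apply: sumr_ge0.
have l0 : 0 < `|P`_m| by rewrite normr_gt0 -[P`_m]/(lead_coef P) lead_coef_eq0.
exists (1 + 2 * S / `|P`_m|) => a ha.
have q0 : 0 <= 2 * S / `|P`_m| by rewrite divr_ge0 // mulr_ge0.
have a1 : 1 <= a by lra.
have a00 : 0 < a by lra.
have aS : 2 * S <= `|P`_m| * a.
  by rewrite [leRHS]mulrC -ler_pdivrMr //; lra.
have [Q [QE Qs Qint Qb]] := synthetic_division P a1.
pose low := \sum_(i < m) `|P`_i| * a ^+ i.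
have lowS : low * a <= S * a ^+ m.
  rewrite /low /S !mulr_suml; apply: ler_sum => i _.
  by rewrite -mulrA -exprSr ler_wpM2l // ler_weXn2l.
have am : 0 < a ^+ m by rewrite exprn_gt0.
have low2 : 2 * low <= `|P`_m| * a ^+ m.
  rewrite -(ler_pM2r a00) -mulrA; apply: (@le_trans _ _ (2 * (S * a ^+ m))).
    by rewrite ler_wpM2l.
  by rewrite mulrA [leRHS]mulrAC ler_wpM2r // ltW.
have AE : sizeA P a = low + `|P`_m| * a ^+ m by rewrite /sizeA sP big_ord_recr.
have PE : `|P`_m| * a ^+ m <= `|P.[a]| + low.
  have -> : `|P`_m| * a ^+ m = `|P.[a] - \sum_(i < m) P`_i * a ^+ i|.
    rewrite horner_coef sP big_ord_recr /= addrC addrK normrM [`|a ^+ m|]ger0_norm //.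
    exact: ltW.
  apply: le_trans (ler_normB _ _) _; rewrite lerD2l.
  apply: le_trans (ler_norm_sum _ _ _) _; apply: ler_sum => i _.
  by rewrite normrM [`|a ^+ _|]ger0_norm // exprn_ge0 // ltW.
have lm : 0 < `|P`_m| * a ^+ m by rewrite mulr_gt0.
have Pa0 : 0 < `|P.[a]| by lra.
exists Q; split => //; first by rewrite -normr_gt0.
move=> i; rewrite normrM normfV mulrC ler_pdivrMr // mulrAC ler_pdivlMr //.
apply: le_trans (Qb i) _; lra.
Qed.

End Resolvent.

(** * Polynomials acting on one-parameter subgroups *)

Lemma prodg_cvg (G : topGroupType) (X I : Type) (F : set_system X) {FF : Filter F}
    (r : seq I) (f : I -> X -> G) (l : I -> G) :
  (forall i, f i x @[x --> F] --> l i) ->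
  \big[*%g/1%g]_(i <- r) f i x @[x --> F] --> \big[*%g/1%g]_(i <- r) l i.
Proof.
move=> fl; elim: r => [|i r IH].
  rewrite (_ : (fun x => _) = fun=> 1%g); last by apply/funext => s; rewrite big_nil.
  by rewrite big_nil; exact: cvg_cst.
rewrite (_ : (fun x => _) = fun x => (f i x * \big[*%g/1%g]_(i <- r) f i x)%g);
  last by apply/funext => s; rewrite big_cons.
by rewrite big_cons; apply: mulg_cvg.
Qed.

Section OrbitHom.
Variables (R : realType) (G : topGroupType) (T : top_aut G) (e : R -> G).
Hypothesis ep : central_param e.
Implicit Types p q : {poly R}.

Lemma aut_center z : centerg G z -> centerg G (T z).
Proof.
move=> zC g; rewrite -[g](homeo_invK T) /commute -!autM; congr (T _); exact: zC.
Qed.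

Lemma iter_aut1 k : iter k T 1%g = 1%g.
Proof. by elim: k => //= k ->; exact: aut1. Qed.

Lemma iter_aut_inj k : injective (iter k T).
Proof.
by elim: k => //= k IH x y /(can_inj (homeo_funK T)); exact: IH.
Qed.

Lemma iter_aut_param k : central_param (iter k T \o e).
Proof.
elim: k => [|k [[c m] z]]; first exact: ep.
split; first split.
- move=> t; apply: (@continuous_comp _ _ _ (iter k T \o e) T); first exact: c.
  exact: homeo_fun_continuous.
- by move=> s t; have := m s t => /= ->; rewrite autM.
- by move=> t; apply: aut_center; exact: z.
Qed.

(** The action of R[X] on one-parameter subgroups in which X acts as T: this is
    the value at time 1 of p . e. *)
Definition orbit_hom p : G := \big[*%g/1%g]_(i < size p) iter i T (e p`_i).

Let e0 : e 0 = 1%g := hom0 ep.1.2.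

Lemma orbit_homE p m : (size p <= m)%N ->
  orbit_hom p = \big[*%g/1%g]_(i < m) iter i T (e p`_i).
Proof.
move=> pm; rewrite /orbit_hom (big_ord_widen m (fun i => iter i T (e p`_i))) // big_mkcond.
apply: eq_bigr => i _; case: ltnP => // pi.
by rewrite nth_default // e0 iter_aut1.
Qed.

Lemma orbit_homD : {morph orbit_hom : p q / p + q >-> (p * q)%g}.
Proof.
move=> p q; pose m := maxn (size p) (size q).
rewrite (@orbit_homE (p + q) m) ?size_polyD // (@orbit_homE p m) ?leq_maxl //.
rewrite (@orbit_homE q m) ?leq_maxr // -prodgM_commute.
  apply: eq_bigr => i _; rewrite coefD; exact: (iter_aut_param i).1.2.
by move=> i j _ _; have [_] := iter_aut_param i; apply.
Qed.

Lemma orbit_hom_center p : centerg G (orbit_hom p).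
Proof.
rewrite /orbit_hom; elim/big_ind: _ => [g|x y xC yC g|i _].
- exact/commute_sym/commute1.
- by apply/commute_sym/commuteM; apply: commute_sym.
- by have [_] := iter_aut_param i; apply.
Qed.

Lemma orbit_homMX p : orbit_hom (p * 'X) = T (orbit_hom p).
Proof.
have [->|p0] := eqVneq p 0; first by rewrite mul0r /orbit_hom size_poly0 big_ord0 aut1.
rewrite {1}/orbit_hom size_mulX // big_ord_recl coefMX eqxx e0 mul1g.
rewrite /orbit_hom (big_morph T (@autM _ T) (aut1 T)).
by apply: eq_bigr => i _; rewrite coefMX.
Qed.

Lemma orbit_homMXn p k : orbit_hom (p * 'X^k) = iter k T (orbit_hom p).
Proof. by elim: k => [|k IH]; rewrite ?mulr1 // exprSr mulrA orbit_homMX IH. Qed.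

Lemma orbit_homC c : orbit_hom c%:P = e c.
Proof. by rewrite (@orbit_homE _ 1) ?size_polyC_leq1 // big_ord1 coefC. Qed.

Lemma orbit_hom_line p : central_param (fun t => orbit_hom (t *: p)).
Proof.
split; last by move=> t; exact: orbit_hom_center.
split; last by move=> s t; rewrite scalerDl orbit_homD.
move=> t; rewrite /continuous_at (@orbit_homE _ (size p)) ?size_scale_leq //.
rewrite (_ : (fun t => _) = fun t => \big[*%g/1%g]_(i < size p) iter i T (e (t *: p)`_i)); last first.
  by apply/funext => s; rewrite (@orbit_homE _ (size p)) ?size_scale_leq.
apply: prodg_cvg => i.
have [[c _] _] := iter_aut_param i.
have h : (s *: p)`_i @[s --> t] --> (t *: p)`_i.
  rewrite coefZ (_ : (fun s => _) = fun s => s * p`_i); last by apply/funext => s; rewrite coefZ.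
  exact: mulrr_continuous.
exact: (@cvg_comp _ _ _ (fun s => (s *: p)`_i) (iter i T \o e) _ _ _ h (c _)).
Qed.

Lemma orbit_hom_rV_continuous m : continuous (fun x : 'rV[R]_m => orbit_hom (rVpoly x)).
Proof.
have E (x : 'rV[R]_m) : orbit_hom (rVpoly x) = \big[*%g/1%g]_(i < m) iter i T (e (x 0 i)).
  rewrite (@orbit_homE _ m) ?size_poly //.
  by apply: eq_bigr => i _; rewrite coef_rVpoly_ord.
move=> x; rewrite /continuous_at E.
rewrite (_ : (fun x => _) = fun x : 'rV[R]_m => \big[*%g/1%g]_(i < m) iter i T (e (x 0 i)));
  last by apply/funext => y; rewrite E.
apply: (@prodg_cvg _ _ _ (nbhs x) (nbhs_filter x)) => i.
have [[c _] _] := iter_aut_param i.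
have h : (fun y : 'rV[R]_m => y 0 i) y @[y --> x] --> x 0 i by exact: coord_continuous.
exact: (@cvg_comp _ _ _ (fun y : 'rV[R]_m => y 0 i) (iter i T \o e) _ _ _ h (c _)).
Qed.

Hypothesis e1 : e 1 = 1%g.

Lemma orbit_hom_int p : p \is a polyOver Num.int_num_subdef -> orbit_hom p = 1%g.
Proof.
move=> /polyOverP pint; rewrite /orbit_hom big1 // => i _.
have /intrP[z ->] := pint i.
by rewrite (param_int ep.1.2 e1) iter_aut1.
Qed.

End OrbitHom.

(** * Integer relations between iterates of a circle *)

Section OrbitRelation.
Variables (R : realType) (G : topGroupType) (n : nat).
Hypothesis lieG : lie_group R G n.
Variables (T : top_aut G) (e : R -> G).
Hypothesis ep : central_param e.
Hypothesis e1 : e 1 = 1%g.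

Notation th := (orbit_hom T e).

Let hG : hausdorff_space G. Proof. by case: lieG. Qed.

Let thD : {morph th : p q / p + q >-> (p * q)%g} := orbit_homD T ep.

Let th_rVD m : {morph (fun x : 'rV[R]_m => th (rVpoly x)) : x y / x + y >-> (x * y)%g}.
Proof. by move=> x y; rewrite linearD thD. Qed.

Let th_cont m : continuous (fun x : 'rV[R]_m => th (rVpoly x)).
Proof. by move=> x; exact: orbit_hom_rV_continuous. Qed.

(** The polynomials of size at most 2n+1 suffice, because 2 * 3^n <= 2^(2n+1). *)
Lemma orbit_killed : exists2 p : {poly R}, p != 0 & forall t, th (t *: p) = 1%g.
Proof.
have [psi [r [C lin]]] := lie_group_linearizing lieG.
have big_k : (2 * 3 ^ n <= 2 ^ (2 * n).+1)%N.
  rewrite expnS expnM leq_mul2l /=.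
  by case: (posnP n) => [->|n0]; rewrite ?expn0 ?leq_exp2r.
have [v v0 Hv] := kernel_line hG (th_cont (m := _)) (th_rVD (m := _))
  (packing lin hG (th_cont (m := _)) (th_rVD (m := _)) big_k).
exists (rVpoly v); last by move=> t; rewrite -linearZ Hv.
apply: contra v0 => /eqP v0; rewrite -[v]rVpolyK v0; apply/eqP; exact: linear0.
Qed.

(** Let p be monic of least degree among the nonzero real polynomials with
    p . e trivial.  The polynomials q of smaller degree with (q . e)(1) = 1 then
    form a discrete group.  It contains j p - floor(j p) for every j, where the
    floor is taken coefficientwise; these are bounded, so two of them coincide,
    and a nonzero multiple of p has integer coefficients. *)
Lemma orbit_relation : exists P : {poly R},
  [/\ P \is a polyOver Num.int_num_subdef, P != 0, P`_0 != 0 &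
      forall q, th (q * P) = 1%g].
Proof.
pose killed m := `[< exists p : {poly R}, [/\ p != 0, size p = m & forall t, th (t *: p) = 1%g] >].
have exk : exists m, killed m.
  by have [p p0 Hp] := orbit_killed; exists (size p); apply/asboolP; exists p.
case: (ex_minnP exk) => s /asboolP[p' [p'0 sp' Hp']] smin.
pose p : {poly R} := (lead_coef p')^-1 *: p'.
have l0 : lead_coef p' != 0 by rewrite lead_coef_eq0.
have p0 : p != 0 by rewrite scaler_eq0 invr_eq0 negb_or l0.
have sp : size p = s by rewrite size_scale ?invr_eq0.
have Hp t : th (t *: p) = 1%g by rewrite scalerA Hp'.
have minp (q : {poly R}) : (size q < s)%N -> (forall t, th (t *: q) = 1%g) -> q = 0.
  move=> qs Hq; apply/eqP/negPn/negP => q0.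
  have /smin : killed (size q) by apply/asboolP; exists q.
  by rewrite leqNgt qs.
have [m sm] : exists m, s = m.+1.
  by exists s.-1; rewrite prednK // -sp size_poly_gt0.
have pm : p`_m = 1.
  have -> : m = (size p').-1 by rewrite sp' sm.
  by rewrite coefZ mulVf.
have p00 : p`_0 != 0.
  apply/eqP => pz; have /factor_theorem[q pq] : root p 0.
    by rewrite /root horner_coef0 pz.
  rewrite subr0 in pq.
  have q0 : q != 0 by apply: contra p0 => /eqP q0; rewrite pq q0 mul0r.
  suff : q = 0 by apply/eqP.
  apply: minp; first by rewrite -sp pq size_mulX.
  move=> t; apply: (can_inj (homeo_funK T)).
  by rewrite -(orbit_homMX T ep) -scalerAl -pq Hp aut1.
have [delta [d0 discr]] : exists delta : R, 0 < delta /\ forall x : 'rV[R]_m,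
    `|x| <= delta -> th (rVpoly x) = 1%g -> x = 0.
  apply: contrapT => H.
  have [|v v0 Hv] := kernel_line hG (th_cont (m := m)) (th_rVD (m := m)).
    move=> delta d0; apply: contrapT => H2; apply: H; exists delta; split => // x xd thx.
    apply/eqP/negPn/negP => x0; apply: H2; exists x => //.
    by rewrite normr_gt0 x0.
  move/eqP: v0; apply; rewrite -[v]rVpolyK.
  have -> : rVpoly v = 0; last by rewrite linear0.
  apply: minp; first by rewrite sm ltnS size_poly.
  by move=> t; rewrite -linearZ Hv.
pose F (j : nat) : {poly R} := \poly_(i < s) (Num.floor (j%:R * p`_i))%:~R.
have Fint j : F j \is a polyOver Num.int_num_subdef.
  by apply: polyOver_poly => i _; exact: intr_int.
pose r j : 'rV[R]_m := \row_i (j%:R * p`_i - (Num.floor (j%:R * p`_i))%:~R).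
have rE j : rVpoly (r j) = j%:R *: p - F j.
  apply/polyP => i; rewrite coefB coefZ coef_rVpoly /F coef_poly.
  case: insubP => [i' im ii'|].
    by rewrite mxE ii' sm ltnS (ltnW im).
  rewrite -leqNgt => mi; move: mi; rewrite leq_eqVlt => /orP[/eqP <-|mi].
    by rewrite sm ltnSn pm mulr1 -[j%:R]/(j%:~R) intrKfloor subrr.
  by rewrite sm ltnNge mi /= nth_default ?mulr0 ?subr0 // sp sm.
have thr j : th (rVpoly (r j)) = 1%g.
  by rewrite rE (homB thD) Hp (orbit_hom_int T ep e1 (Fint j)) mulgV.
have rB j : `|r j| <= 1.
  apply: rV_norm_le => // i; rewrite mxE.
  have /andP[h1 h2] := frac_itv (j%:R * p`_i).
  by rewrite ger0_norm; lra.
pose M := (Num.bound (2 / delta)).+1.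
have M0 : 0 < M%:R :> R by rewrite ltr0n.
have [||i [j [ij rij]]] := @bounded_pigeonhole R m 'I_((M.+1 ^ m).+1) (fun i => r i) 1 M ltr01 isT.
- by move=> i; exact: rB.
- by rewrite card_ord.
have rr : r i = r j.
  apply/eqP; rewrite -subr_eq0; apply/eqP; apply: discr.
    apply: le_trans rij _; rewrite mulr1 ler_pdivrMr // mulrC -ler_pdivrMr //.
    apply: ltW; apply: lt_trans (archi_boundP _) _; first by rewrite divr_ge0 // ltW.
    by rewrite ltr_nat.
  by have := homB (th_rVD (m := m)) (r i) (r j); rewrite /= => ->; rewrite !thr mulgV.
have PE : ((i%:R : R) - j%:R) *: p = F i - F j.
  have E : i%:R *: p = j%:R *: p - F j + F i by rewrite -rE -rr rE subrK.
  by rewrite scalerBl E; ring.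
have ij0 : (i%:R : R) - j%:R != 0.
  by rewrite subr_eq0 eqr_nat.
exists ((i%:R - j%:R) *: p); split.
- by rewrite PE rpredB.
- by rewrite scaler_eq0 negb_or ij0.
- by rewrite coefZ mulf_neq0.
elim/poly_ind => [|q c IH]; first by rewrite mul0r -(scale0r p) Hp.
rewrite mulrDl thD mulrAC (orbit_homMX T ep) IH aut1 mul1g mul_polyC scalerA.
exact: Hp.
Qed.

End OrbitRelation.

(** * Fixed points approached by whole orbits *)

Section NotExpansive.
Variables (R : realType) (G : topGroupType) (T : top_aut G).

(** Membership in neighbourhoods may be tested on the subbase, uniformly along a
    family of orbits, because the sets that pass the test form a filter. *)
Lemma chabauty_filter (I : Type) (F : set_system I) {FF : Filter F}
    (J : Type) (x : J -> I -> closed_subgroup G) (H : closed_subgroup G) :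
  (forall A, chabauty_subbase A -> A H -> \forall a \near F, forall j, A (x j a)) ->
  forall N, nbhs H N -> \forall a \near F, forall j, N (x j a).
Proof.
move=> sub N; rewrite nbhsE => -[_ [[D Dfin <-] [B DB BH]] BN].
have [K sK KB'] := Dfin _ DB.
have KB : _ = (B : set (closed_subgroup G)) := KB'.
have KF := @filter_bigI _ _ K (fun A => [set a | forall j, A (x j a)]) F FF.
apply: filterS (KF _).
  move=> a Ka j; apply: BN; exists B => //.
  suff : (B : set (closed_subgroup G)) (x j a) by [].
  by rewrite -KB => A AK; exact: Ka.
move=> A AK; apply: sub; first by apply/set_mem/sK.
have : (B : set (closed_subgroup G)) H by exact: BH.
by rewrite -KB; apply.
Qed.

Lemma homeo_iter_fix (X : topologicalType) (phi : self_homeo X) (x : X) :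
  phi x = x -> forall n, homeo_iter phi n x = x.
Proof.
move=> fx.
have ifx : homeo_inv phi x = x by rewrite -{1}fx homeo_funK.
by case => k; [|rewrite /homeo_iter iterS]; elim: k => //= k ->.
Qed.

Lemma homeo_iter_val (n : int) (h : Subp R G) :
  set_val (homeo_iter (Subp_homeo R T) n h) = homeo_iter (chabauty_homeo T) n (set_val h).
Proof.
have pos T' k : set_val (iter k (@Subp_image G R T') h) = iter k (csub_image T') (set_val h).
  by elim: k => // k IH; rewrite !iterS -IH.
by case: n => k; [exact: (pos T k)|exact: (pos (top_aut_inv T) k.+1)].
Qed.

(** The orbit of x a stays close to H, whose orbit is constant, so that no
    positive constant can separate them.  The same points x a show that H is a
    limit of closed one-parameter subgroups. *)
Lemma not_expansive_near_fixed (H : closed_subgroup G) (x : nat -> closed_subgroup G) :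
  csub_image T H = H ->
  (forall a, closed_one_param R G (x a)) -> (forall a, x a <> H) ->
  (forall a n, homeo_iter (chabauty_homeo T) n (x a) `<=` H) ->
  (forall U, open U -> H `&` U !=set0 -> \forall a \near \oo,
     forall n, homeo_iter (chabauty_homeo T) n (x a) `&` U !=set0) ->
  ~ acts_expansively_on_Subp R T.
Proof.
move=> TH xp xH subH hitU [d [d0 _ _ dn] [e e0 He]].
have near_H := @chabauty_filter nat \oo _ int
  (fun n a => homeo_iter (chabauty_homeo T) n (x a)) H.
have {}near_H N : nbhs H N -> \forall a \near \oo,
    forall n, N (homeo_iter (chabauty_homeo T) n (x a)).
  apply: near_H => A [[K cK <-]|[U oU <-]] AH; last exact: hitU.
  apply: nearW => a n; apply/seteqP; split=> // g [xg Kg].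
  by have : (H `&` K) g; [split => //; exact: subH xg|rewrite AH].
have SE : Subp R G = closure (closed_one_param R G) by rewrite /Subp -closureE.
have SH : Subp R G H.
  rewrite SE => B HB.
  have [a Ha] := filter_ex (near_H _ HB).
  by exists (x a); split; [exact: xp|exact: (Ha 0)].
have Sx a : Subp R G (x a) by rewrite SE; apply: subset_closure; exact: xp.
pose h : Subp R G := exist _ H (mem_set SH).
pose y a : Subp R G := exist _ (x a) (mem_set (Sx a)).
have : nbhs h [set z | d h z < e / 2].
  by apply/dn; exists (e / 2) => //; rewrite divr_gt0.
rewrite nbhsE => -[_ [[V oV <-] Vh] Vd].
have [a Ha] : exists a, forall n, V (homeo_iter (chabauty_homeo T) n (x a)).
  by have /filter_ex[a Ha] := near_H V (open_nbhs_nbhs (conj oV Vh)); exists a.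
have hy : h <> y a by move=> /(congr1 val) /= /esym; exact: xH.
have := He _ _ hy; apply/negP; rewrite -leNgt.
apply: ge_ereal_sup => _ [n _ <-].
have -> : homeo_iter (Subp_homeo R T) n h = h.
  by apply: homeo_iter_fix; apply: val_inj; exact: TH.
rewrite lee_fin; apply: ltW; apply: (@lt_trans _ _ (e / 2)); last by lra.
by apply: Vd; rewrite /= homeo_iter_val; exact: Ha.
Qed.

End NotExpansive.

(** * Circles as closed subgroups *)

Lemma range_subgroup (G : topGroupType) (V : zmodType) (f : V -> G) :
  {morph f : x y / x + y >-> (x * y)%g} -> closed (range f) ->
  exists H : closed_subgroup G, csub_set H = range f.
Proof.
move=> fD cf.
have h1 : range f 1%g by exists 0 => //; exact: hom0.
have hM x y : range f x -> range f y -> range f (x * y)%g.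
  by move=> [u _ <-] [v _ <-]; exists (u + v).
have hV x : range f x -> range f (x^-1)%g.
  by move=> [u _ <-]; exists (- u) => //; exact: homN.
by exists (ClosedSubgroup h1 hM hV cf).
Qed.

Lemma circle_subgroup (R : realType) (G : topGroupType) (w : R -> G) :
  hausdorff_space G -> one_param w -> w 1 = 1%g ->
  exists H : closed_subgroup G, csub_set H = range w.
Proof.
move=> hG [wc wD] w1; apply: range_subgroup => //.
have -> : range w = [set w t | t in `[0, 1]].
  apply/seteqP; split => [_ [t _ <-]|_ [t _ <-]]; last by exists t.
  exists (t - (Num.floor t)%:~R); last by rewrite -param_frac.
  by rewrite /= in_itv /= frac_itv.
apply: compact_closed => //; apply: continuous_compact.
  exact: continuous_subspaceT.
exact: segment_compact.
Qed.

Section SubgroupOrbits.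
Variables (G : topGroupType) (T : top_aut G).
Implicit Types H K : closed_subgroup G.

Lemma csub_expg H g k : csub_set H g -> csub_set H (g ^+ k)%g.
Proof. by move=> Hg; elim: k => [|k IH]; [exact: csub1|rewrite expgS; exact: csubM]. Qed.

Lemma iter_image_sub (T' : top_aut G) H K k : csub_image T' H = H -> K `<=` H ->
  iter k (csub_image T') K `<=` H.
Proof.
move=> TH KH; elim: k => // k IH; rewrite iterS -TH /= => _ [g Kg <-].
by exists g => //; exact: IH.
Qed.

Lemma orbit_sub_fixed H K n : csub_image T H = H -> K `<=` H ->
  homeo_iter (chabauty_homeo T) n K `<=` H.
Proof.
move=> TH KH; case: n => k; first exact: iter_image_sub.
by apply: (iter_image_sub (T' := top_aut_inv T)) => //; rewrite -{1}TH csub_imageK.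
Qed.

Lemma mem_iter_image (T' : top_aut G) K k g :
  csub_set K g -> csub_set (iter k (csub_image T') K) (iter k T' g).
Proof. by move=> Kg; elim: k => // k IH; rewrite !iterS; exists (iter k T' g). Qed.

(** For n >= 0, g is the image under T^n of T^(n(r-1)) g. *)
Lemma mem_orbit_periodic K g r n : (forall k, csub_set K (iter k T g)) ->
  (0 < r)%N -> iter r T g = g -> csub_set (homeo_iter (chabauty_homeo T) n K) g.
Proof.
move=> Kg r0 per.
case: n => k; last first.
  have := mem_iter_image (top_aut_inv T) k.+1 (Kg k.+1).
  suff -> : iter k.+1 (top_aut_inv T) (iter k.+1 T g) = g by [].
  elim: (k.+1) => // l IH; rewrite iterSr (iterS l T) -[RHS]IH.
  by congr (iter l _ _); exact: homeo_funK.
have := mem_iter_image T k (Kg (k * r.-1)%N).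
rewrite -iterD -mulnS prednK //.
suff -> : iter (k * r) T g = g by [].
by elim: k => // k IH; rewrite mulSn iterD IH.
Qed.

End SubgroupOrbits.

(** * The invariant torus generated by a circle *)

Lemma powers_mod_repeat (A N : nat) : (0 < N)%N ->
  exists i j q : nat, (i < j)%N /\ (A ^ j = A ^ i + q * N)%N \/ (i < j)%N /\ (A ^ i = A ^ j + q * N)%N.
Proof.
move=> N0.
pose f (i : 'I_N.+1) : 'I_N := Ordinal (ltn_pmod (A ^ i) N0).
have [i [j [ij fij]]] : exists i j : 'I_N.+1, (i < j)%N /\ f i = f j.
  apply: contrapT => H.
  have inj : injective f.
    move=> i j fij; apply: contrapT => ij; apply: H.
    have := ltn_neqAle; have [ij'|ij'|/val_inj//] := ltngtP i j.
      by exists i, j.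
    by exists j, i.
  by have := leq_card f inj; rewrite !card_ord ltnn.
have E : (A ^ i = A ^ j %[mod N])%N by have [] := congr1 val fij.
exists i, j.
have [le|/ltnW le] := leqP (A ^ i) (A ^ j).
  have : (N %| A ^ j - A ^ i)%N by rewrite -eqn_mod_dvd // E.
  by move=> /dvdnP[q Hq]; exists q; left; split => //; rewrite -Hq subnKC.
have : (N %| A ^ i - A ^ j)%N by rewrite -eqn_mod_dvd // E.
by move=> /dvdnP[q Hq]; exists q; right; split => //; rewrite -Hq subnKC.
Qed.

Section CyclicOrbit.
Variables (R : realType) (G : topGroupType) (n : nat).
Hypothesis lieG : lie_group R G n.
Variables (T : top_aut G) (e : R -> G).
Hypothesis ep : central_param e.
Hypothesis e1 : e 1 = 1%g.

Notation th := (orbit_hom T e).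

Let hG : hausdorff_space G. Proof. by case: lieG. Qed.

Let thD : {morph th : p q / p + q >-> (p * q)%g} := orbit_homD T ep.

Section Relation.
Variable P : {poly R}.
Hypothesis Pint : P \is a polyOver Num.int_num_subdef.
Hypothesis P0 : P != 0.
Hypothesis P00 : P`_0 != 0.
Hypothesis HP : forall q, th (q * P) = 1%g.

Let thDP p q : th (p + q * P) = th p.
Proof. by rewrite thD HP mulg1. Qed.

(** Reducing modulo P and modulo integer polynomials exhibits the range as the
    image of a cube. *)
Lemma orbit_hom_subgroup : exists H : closed_subgroup G, csub_set H = range th.
Proof.
apply: range_subgroup => //.
pose m := size P.
have -> : range th = [set th (rVpoly x) | x in [set x : 'rV[R]_m | `|x - 0| <= 1]].
  apply/seteqP; split => [_ [p _ <-]|_ [x _ <-]]; last by exists (rVpoly x).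
  pose q := p %% P.
  pose x : 'rV[R]_m := \row_i (q`_i - (Num.floor q`_i)%:~R).
  pose F := \poly_(i < m) ((Num.floor q`_i)%:~R : R).
  have Fint : F \is a polyOver Num.int_num_subdef.
    by apply: polyOver_poly => i _; exact: intr_int.
  have qm : (size q <= m)%N by apply: ltnW; rewrite ltn_modp.
  have xE : rVpoly x = q - F.
    apply/polyP => i; rewrite coefB coef_rVpoly /F coef_poly.
    case: insubP => [i' im ii'|]; first by rewrite mxE ii' im.
    by move=> im; rewrite (negPf im) nth_default ?subr0 // (leq_trans qm) // leqNgt.
  exists x.
    rewrite /= subr0; apply: rV_norm_le => // i; rewrite mxE.
    by have /andP[h1 h2] := frac_itv q`_i; rewrite ger0_norm.
  rewrite xE (homB thD) (orbit_hom_int T ep e1 Fint) invg1 mulg1.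
  by rewrite [in RHS](divp_eq p P) addrC thDP.
apply: compact_closed => //; apply: continuous_compact.
  by apply: continuous_subspaceT => x; exact: orbit_hom_rV_continuous.
exact: closed_ballrV_compact.
Qed.

(** Since P_0 is nonzero, X is invertible modulo P. *)
Lemma orbit_hom_fixed (H : closed_subgroup G) : csub_set H = range th ->
  csub_image T H = H.
Proof.
move=> HE; apply: csub_inj => /=; rewrite HE.
apply/seteqP; split => [_ [_ [p _ <-] <-]|_ [p _ <-]].
  by exists (p * 'X) => //; rewrite orbit_homMX.
have /factor_theorem[P1 HP1] : root (P - (P`_0)%:P) 0.
  by rewrite /root hornerD hornerN hornerC horner_coef0 subrr.
rewrite subr0 in HP1.
exists (th ((- (P`_0)^-1) *: (P1 * p))); first by exists ((- (P`_0)^-1) *: (P1 * p)).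
rewrite -(orbit_homMX T ep) -scalerAl mulrAC -HP1 -[RHS](thDP p (- (P`_0)^-1 *: p)); congr th.
rewrite mulrBl scalerBr -scalerAl [_ * P]mulrC mul_polyC scalerA mulNr mulVf //.
by rewrite scaleN1r opprK addrC.
Qed.

Section Resolvent.
Variables (A : nat) (Q : {poly R}).
Let a : R := A%:R.
Hypothesis a1 : 1 <= a.
Hypothesis Pa0 : P.[a] != 0.
Hypothesis QE : (a%:P - 'X) * Q = P.[a]%:P - P.
Hypothesis Qint : Q \is a polyOver Num.int_num_subdef.

Let u := P.[a]^-1 *: Q.

(** u is (a - X)^-1 modulo P. *)
Lemma orbit_hom_resolvent p : th (p * (a%:P - 'X) * u) = th p.
Proof.
rewrite -(thDP (p * (a%:P - 'X) * u) (P.[a]^-1 *: p)); congr th.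
rewrite /u -scalerAr -mulrA QE -scalerAl -scalerDr mulrBr subrK mulrC mul_polyC.
by rewrite scalerA mulVf // scale1r.
Qed.

Let thuZ Z : Z \is a polyOver Num.int_num_subdef -> th (Z * u) = th (Z.[a] *: u).
Proof.
move=> Zint.
have aint : a \in Num.int_num_subdef by exact: natr_int.
have [Z' [Z'E _ Z'int _]] := synthetic_division Z a1.
have -> : Z * u = Z.[a] *: u - Z' * (a%:P - 'X) * u.
  by rewrite [Z' * _]mulrC Z'E mulrBl mul_polyC opprB addrC subrK.
by rewrite (homB thD) orbit_hom_resolvent (orbit_hom_int T ep e1 (Z'int Zint aint)) invg1 mulg1.
Qed.

Let iter_thu k : iter k T (th u) = th (a ^+ k *: u).
Proof.
rewrite -(orbit_homMXn T ep) mulrC thuZ ?hornerXn // rpredX //; exact: polyOverX.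
Qed.

Variable K : closed_subgroup G.
Hypothesis KE : csub_set K = range (fun t => th (t *: Q)).

Let K_u t : csub_set K (th (t *: u)).
Proof. by rewrite KE; exists (t * P.[a]^-1) => //; rewrite -scalerA. Qed.

(* u has finite order modulo integer polynomials, and a power of a repeats modulo
   that order *)
Let u_periodic : exists2 r, (0 < r)%N & iter r T (th u) = th u.
Proof.
have /intrP[c cE] : P.[a] \is a Num.int.
  by apply: (rpred_horner Pint); exact: natr_int.
have c0 : (0 < `|c|)%N by rewrite absz_gt0; apply: contra Pa0 => /eqP c0; rewrite cE c0.
have [s sint sE] : exists2 s : R, s \in Num.int_num_subdef & `|c|%N%:R = s * P.[a].
  rewrite cE; case: (c) => m.
    by exists 1; [exact: rpred1|rewrite mul1r].
  by exists (- 1); [rewrite rpredN; exact: rpred1|rewrite NegzE mulrNz mulrNN mul1r].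
have Qc q : th ((q * `|c|)%N%:R *: u) = 1%g.
  have -> : (q * `|c|)%N%:R *: u = (q%:R * s) *: Q.
    by rewrite /u scalerA natrM sE mulrA mulfK.
  apply: (orbit_hom_int T ep e1); apply: polyOverZ => //.
  by rewrite rpredM //; exact: natr_int.
have inj i j : (i < j)%N -> th (a ^+ i *: u) = th (a ^+ j *: u) ->
    exists2 r, (0 < r)%N & iter r T (th u) = th u.
  move=> ij; rewrite -!iter_thu => E; exists (j - i)%N; first by rewrite subn_gt0.
  by apply: (@iter_aut_inj _ T i); rewrite -iterD subnKC // ltnW.
have [i [j [q]]] := powers_mod_repeat A c0.
by case=> -[ij /(congr1 (fun m => m%:R : R))]; rewrite natrD !natrX -/a => E;
  apply: (inj i j ij); rewrite E scalerDl thD Qc mulg1.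
Qed.

(** T acts on the value of u as raising to the power a, so the finite cyclic
    group generated by that value, which lies on the circle K of Q, is
    T-invariant; hence it lies on every T^n K. *)
Lemma int_orbit_in (Z : {poly R}) k : Z \is a polyOver Num.int_num_subdef ->
  csub_set (homeo_iter (chabauty_homeo T) k K) (th (Z * u)).
Proof.
move=> Zint; have [r r0 per] := u_periodic.
have mem : csub_set (homeo_iter (chabauty_homeo T) k K) (th u).
  by apply: mem_orbit_periodic r0 per => l; rewrite iter_thu; exact: K_u.
rewrite thuZ //.
have aint : a \in Num.int_num_subdef by exact: natr_int.
have /intrP[[m|m] ->] : Z.[a] \is a Num.int by exact: (rpred_horner Zint).
  by rewrite -pmulrn scaler_nat (homMn thD); exact: csub_expg.
rewrite NegzE mulrNz scaleNr (homN thD) -pmulrn scaler_nat (homMn thD).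
by apply: csubV; exact: csub_expg.
Qed.

End Resolvent.
End Relation.
End CyclicOrbit.

Section FractionalPart.
Variable R : realType.
Implicit Types Y u : {poly R}.

Definition frac_poly Y : {poly R} := \poly_(i < size Y) (Y`_i - (Num.floor Y`_i)%:~R).

Lemma frac_poly_coef Y i : `|(frac_poly Y)`_i| <= 1.
Proof.
rewrite coef_poly; case: ifP => _; last by rewrite normr0.
by have /andP[h1 h2] := frac_itv Y`_i; rewrite ger0_norm.
Qed.

Lemma sub_frac_poly_int Y : Y - frac_poly Y \is a polyOver Num.int_num_subdef.
Proof.
apply/polyOverP => i; rewrite coefB coef_poly; case: ltnP => Yi.
  by rewrite opprB addrC subrK; exact: intr_int.
by rewrite nth_default // subrr; exact: rpred0.
Qed.

Lemma coefM_small (p q : {poly R}) (B : R) k i : (forall j, `|p`_j| <= 1) ->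
  (forall j, `|q`_j| <= B) -> (i < k)%N -> `|(p * q)`_i| <= k%:R * B.
Proof.
move=> p1 qB ik; rewrite coefM.
have B0 : 0 <= B by apply: le_trans (qB 0%N).
apply: le_trans (ler_norm_sum _ _ _) _.
apply: (@le_trans _ _ (\sum_(j < i.+1) B)).
  by apply: ler_sum => j _; rewrite normrM -[leRHS]mul1r ler_pM.
by rewrite sumr_const card_ord -[B *+ _]mulr_natl ler_wpM2r // ler_nat.
Qed.

End FractionalPart.

Section CyclicCase.
Variables (R : realType) (G : topGroupType) (n : nat).
Hypothesis lieG : lie_group R G n.
Variables (T : top_aut G) (e : R -> G).
Hypothesis ep : central_param e.
Hypothesis e1 : e 1 = 1%g.
Hypothesis ind : independent e (T \o e).

Notation th := (orbit_hom T e).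

(** For large a, every point of the torus, being the value of
    p = p (a - X) u modulo P, is close to the value of floor(p (a - X)) u, which
    lies on every T^n-translate of the circle attached to a. *)
Lemma cyclic_not_expansive : ~ acts_expansively_on_Subp R T.
Proof.
have hG : hausdorff_space G by case: lieG.
have thD := orbit_homD T ep.
have [P [Pint P0 P00 HP]] := orbit_relation lieG T ep e1.
have thDP p q : th (p + q * P) = th p by rewrite thD HP mulg1.
have [H HE] := orbit_hom_subgroup lieG ep e1 P0 HP.
have TH := orbit_hom_fixed ep P00 HP HE.
have [a0 res] := resolvent_small P0.
pose A k := (Num.bound `|a0| + k.+1)%N.
have A0 k : a0 <= (A k)%:R.
  apply: le_trans (ler_norm _) _; apply: ltW; apply: lt_le_trans (archi_boundP _) _ => //.
  by rewrite ler_nat leq_addr.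
have A1 k : 1 <= (A k)%:R :> R by rewrite ler1n /A addnS.
have Ak k : k%:R <= (A k)%:R :> R by rewrite ler_nat /A; apply: leq_trans (leq_addl _ _); exact: leqnSn.
have /choice[Q HQ] := fun k => res _ (A0 k).
have Qint k : Q k \is a polyOver Num.int_num_subdef.
  by have [_ _ _ h _] := HQ k; apply: h => //; exact: natr_int.
pose w k t := th (t *: Q k).
have wp k : central_param (w k) by exact: orbit_hom_line.
have w1 k : w k 1 = 1%g by rewrite /w scale1r; exact: orbit_hom_int.
have /choice[x xE] := fun k => circle_subgroup hG (wp k).1 (w1 k).
apply: (@not_expansive_near_fixed R G T H x) => //.
- by move=> k; exists (w k); split; [exact: (wp k).1.1|exact: (wp k).1.2|exact: xE].
- move=> k xH; have wH : range (w k) = range th by rewrite -xE xH.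
  apply: (range_sub_circle_dependent hG ep (iter_aut_param T ep 1) (wp k) (w1 k)) ind.
    by rewrite wH => _ [t _ <-]; exists t%:P => //; rewrite orbit_homC.
  rewrite wH => _ [t _ <-]; exists (t%:P * 'X) => //.
  by rewrite (orbit_homMX T ep) orbit_homC.
- move=> k m; apply: orbit_sub_fixed => //.
  by rewrite xE HE => _ [t _ <-]; exists (t *: Q k).
move=> U oU [g []]; rewrite HE => -[p _ <-] Up.
pose u k := (P.[(A k)%:R])^-1 *: Q k.
pose Y k := p * ((A k)%:R%:P - 'X).
have YE k : th p = (th ((Y k - frac_poly (Y k)) * u k) * th (frac_poly (Y k) * u k))%g.
  have [Pa0 QE _ _ _] := HQ k.
  by rewrite -thD -mulrDl subrK (orbit_hom_resolvent ep HP Pa0 QE).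
pose s := (size p + size P).+2.
pose v k : 'rV[R]_s := poly_rV (frac_poly (Y k) * u k).
have vE k : rVpoly (v k) = frac_poly (Y k) * u k.
  apply: poly_rV_K.
  have [_ _ Qs _ _] := HQ k.
  have su : (size (u k) <= size P)%N by apply: leq_trans Qs; exact: size_scale_leq.
  have sX : (size ((A k)%:R%:P - 'X : {poly R})%R <= 2)%N.
    by rewrite -opprB size_polyN size_XsubC.
  have sY : (size (Y k) <= (size p).+2)%N.
    apply: leq_trans (size_polyMleq _ _) _; apply: leq_trans (leq_pred _) _.
    by rewrite -addn2 leq_add2l.
  apply: leq_trans (size_polyMleq _ _) _; apply: leq_trans (leq_pred _) _.
  by rewrite /s -!addSn leq_add //; apply: leq_trans sY; exact: size_poly.
have v0 : v k @[k --> \oo] --> (0 : 'rV[R]_s).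
  apply/cvgrPdist_le => d d0.
  exists (Num.bound (s%:R * 3 / d)) => // k /= hk; rewrite sub0r normrN.
  apply: rV_norm_le => [|i]; first exact: ltW.
  have [Pa0 _ _ _ Qb] := HQ k.
  rewrite /v mxE; apply: le_trans (@coefM_small _ _ _ (3 / (A k)%:R) s i _ _ _) _ => //.
  - exact: frac_poly_coef.
  - by move=> j; rewrite coefZ; exact: Qb.
  have A00 : 0 < (A k)%:R :> R by apply: lt_le_trans (A1 k).
  rewrite mulrA ler_pdivrMr // [leRHS]mulrC -ler_pdivrMr //.
  apply: le_trans (Ak k); apply: ltW; apply: lt_le_trans (archi_boundP _) _.
    by rewrite divr_ge0 ?mulr_ge0 // ltW.
  by rewrite ler_nat.
have lim0 : th (rVpoly (v k)) @[k --> \oo] --> th (rVpoly (0 : 'rV[R]_s)).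
  have c : {for 0, continuous (fun y : 'rV[R]_s => th (rVpoly y))}.
    exact: orbit_hom_rV_continuous.
  exact: (@cvg_comp _ _ _ v (fun y : 'rV[R]_s => th (rVpoly y)) _ _ _ v0 c).
rewrite linear0 (hom0 thD) in lim0.
have lim : (th p * (th (rVpoly (v k)))^-1)%g @[k --> \oo] --> (th p * 1^-1)%g.
  by apply: mulg_cvg; [exact: cvg_cst|exact: invg_cvg].
rewrite invg1 mulg1 in lim.
have nU : \forall k \near \oo, U (th p * (th (rVpoly (v k)))^-1)%g.
  by apply: lim; apply: open_nbhs_nbhs.
apply: filterS nU => k Uk m.
have [Pa0 QE _ _ _] := HQ k.
exists (th ((Y k - frac_poly (Y k)) * u k)); split; last first.
  by move: Uk; rewrite /= vE (YE k) mulgK.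
apply: (int_orbit_in ep e1 Pint HP (A1 k) Pa0 QE (Qint k) (xE k)).
exact: sub_frac_poly_int.
Qed.

End CyclicCase.

(** * When T fixes all central circles *)

Section ScalarCase.
Variables (R : realType) (G : topGroupType) (T : top_aut G).
Hypothesis hG : hausdorff_space G.

Lemma dependent_orbit_range (e : R -> G) : one_param e -> ~ independent e (T \o e) ->
  T @` range e = range e.
Proof.
move=> [_ eD] dep.
have e0 := hom0 eD.
have [triv|ntriv] := pselect (forall u, e u = 1%g).
  have -> : range e = [set 1%g].
    by apply/seteqP; split => [_ [u _ <-]|_ ->]; [exact: triv|exists 0].
  by rewrite image_set1 aut1.
have nt s : (forall u, e (s * u) = 1%g) -> s = 0.
  move=> H; apply/eqP/negPn/negP => s0; apply: ntriv => u.
  by rewrite -(mulVKf s0 u) H.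
have [s [t [st H]]] : exists s t, ~ (s = 0 /\ t = 0) /\
    forall u, (e (s * u)%R * T (e (t * u)%R))%g = 1%g.
  by apply: contrapT => H; apply: dep => s t Hst; apply: contrapT => st; apply: H; exists s, t.
have s0 : s != 0.
  apply/eqP => s0; apply: st; split => //; apply: nt => u.
  apply: (can_inj (homeo_funK T)); rewrite aut1.
  by have := H u; rewrite s0 mul0r e0 mul1g.
have t0 : t != 0.
  apply/eqP => t0; apply: st; split => //; apply: nt => u.
  by have := H u; rewrite t0 mul0r e0 aut1 mulg1.
have Te u : T (e u) = e (- (s * (t^-1 * u))).
  have := H (t^-1 * u); rewrite [t * _]mulrA divff // mul1r => E.
  by rewrite (homN eD); apply/esym/mulg1_eq.
apply/seteqP; split => [_ [_ [u _ <-] <-]|_ [u _ <-]].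
  by rewrite Te; exists (- (s * (t^-1 * u))).
exists (e (- (t * (s^-1 * u)))); first by exists (- (t * (s^-1 * u))).
by rewrite Te; congr e; field; rewrite s0 t0.
Qed.

Variables (e f : R -> G).
Hypotheses (ep : central_param e) (fp : central_param f).
Hypotheses (e1 : e 1 = 1%g) (f1 : f 1 = 1%g).
Hypothesis ind : independent e f.
Hypothesis dep : forall w : R -> G, central_param w -> w 1 = 1%g -> ~ independent w (T \o w).

Let th (x : 'rV[R]_2) : G := (e (x 0 0) * f (x 0 1%R))%g.

Let thD : {morph th : x y / x + y >-> (x * y)%g} := commute_morph ep fp.1.

Let pair (s t : R) : 'rV[R]_2 := \row_i (if i == 0 then s else t).

Let th_pair s t : th (pair s t) = (e s * f t)%g.
Proof. by rewrite /th !mxE. Qed.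

Lemma two_torus_subgroup : exists H : closed_subgroup G, csub_set H = range th.
Proof.
apply: range_subgroup => //.
have -> : range th = [set th x | x in [set x : 'rV[R]_2 | `|x - 0| <= 1]].
  apply/seteqP; split => [_ [x _ <-]|_ [x _ <-]]; last by exists x.
  exists (pair (x 0 0 - (Num.floor (x 0 0))%:~R) (x 0 1 - (Num.floor (x 0 1))%:~R)).
    rewrite /= subr0; apply: rV_norm_le => // i; rewrite mxE; case: ifP => _.
      by have /andP[h1 h2] := frac_itv (x 0 0); rewrite ger0_norm.
    by have /andP[h1 h2] := frac_itv (x 0 1); rewrite ger0_norm.
  by rewrite th_pair -(param_frac ep.1.2 e1) -(param_frac fp.1.2 f1).
apply: compact_closed => //; apply: continuous_compact.
  by apply: continuous_subspaceT => x; exact: (pair_continuous ep.1 fp.1).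
exact: closed_ballrV_compact.
Qed.

(** Here T maps every central circle onto itself, and the circles
    t |-> e(t) f(kt) wind ever more densely around the torus spanned by e and f. *)
Lemma scalar_not_expansive : ~ acts_expansively_on_Subp R T.
Proof.
have [H HE] := two_torus_subgroup.
have [[ec eD] eC] := ep; have [[fc fD] fC] := fp.
have e0 := hom0 eD; have f0 := hom0 fD.
pose w (k : nat) (t : R) := (e t * f (k.+1%:R * t)%R)%g.
have wp k : central_param (w k).
  split; first split.
  - move=> t; apply: mulg_cvg; first exact: ec.
    have h : (k.+1%:R * s) @[s --> t] --> k.+1%:R * t by exact: mulrl_continuous.
    by apply: cvg_comp h _; exact: fc.
  - move=> s t; rewrite /w mulrDr eD fD -!mulgA; congr (_ * _)%g.
    by rewrite !mulgA; congr (_ * _)%g; exact: eC.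
  - by move=> t g; apply/commute_sym/commuteM; apply/commute_sym; [exact: eC|exact: fC].
have w1 k : w k 1 = 1%g by rewrite /w mulr1 e1 (param_nat fD f1) mulg1.
have /choice[x xE] := fun k => circle_subgroup hG (wp k).1 (w1 k).
have Te := dependent_orbit_range ep.1 (dep ep e1).
have Tf := dependent_orbit_range fp.1 (dep fp f1).
have rng (a b : R) : range e (e a) /\ range f (f b) by split; [exists a|exists b].
have Tth y : T (th y) = (T (e (y 0 0)) * T (f (y 0 1%R)))%g by rewrite /th autM.
have TH : csub_image T H = H.
  apply: csub_inj => /=; rewrite HE; apply/seteqP; split.
    move=> _ [_ [y _ <-] <-]; rewrite Tth.
    have : (T @` range e) (T (e (y 0 0))) by exists (e (y 0 0)) => //; exists (y 0 0).
    rewrite Te => -[a _ <-].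
    have : (T @` range f) (T (f (y 0 1))) by exists (f (y 0 1)) => //; exists (y 0 1).
    by rewrite Tf => -[b _ <-]; exists (pair a b); rewrite ?th_pair.
  move=> _ [y _ <-]; rewrite -[th y]/(e (y 0 0) * f (y 0 1%R))%g.
  have [+ _] := rng (y 0 0) 0; rewrite -[in X in X -> _]Te => -[_ [a _ <-] <-].
  have [_ +] := rng 0 (y 0 1); rewrite -[in X in X -> _]Tf => -[_ [b _ <-] <-].
  by exists (th (pair a b)); [exists (pair a b)|rewrite th_pair autM].
have Tx k n : homeo_iter (chabauty_homeo T) n (x k) = x k.
  apply: homeo_iter_fix; apply: csub_inj; rewrite /= xE.
  exact: dependent_orbit_range (wp k).1 (dep (wp k) (w1 k)).
apply: (@not_expansive_near_fixed R G T H x) => //.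
- by move=> k; exists (w k); split; [exact: (wp k).1.1|exact: (wp k).1.2|exact: xE].
- move=> k xH; have wH : range (w k) = range th by rewrite -xE xH.
  apply: (range_sub_circle_dependent hG ep fp (wp k) (w1 k)) ind.
    by rewrite wH => _ [t _ <-]; exists (pair t 0) => //; rewrite th_pair f0 mulg1.
  by rewrite wH => _ [t _ <-]; exists (pair 0 t) => //; rewrite th_pair e0 mul1g.
- move=> k m; rewrite Tx xE HE => _ [t _ <-].
  by exists (pair t (k.+1%:R * t)); rewrite ?th_pair.
move=> U oU [g []]; rewrite HE => -[y _ <-] Uy.
(* w k s = e s * f t0 whenever s lies in (t0 + Z) / (k + 1) *)
pose s0 := y 0 0; pose t0 := y 0 1.
pose s (k : nat) := (t0 + (Num.floor (k.+1%:R * s0 - t0))%:~R) / k.+1%:R.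
have slim : s k @[k --> \oo] --> s0.
  apply/cvgrPdist_le => d d0.
  exists (Num.bound d^-1) => // k /= hk.
  have k0 : 0 < k.+1%:R :> R by [].
  have -> : s0 - s k = (k.+1%:R * s0 - t0 - (Num.floor (k.+1%:R * s0 - t0))%:~R) / k.+1%:R.
    by rewrite /s; field; rewrite gt_eqF.
  have /andP[h1 h2] := frac_itv (k.+1%:R * s0 - t0).
  rewrite normrM ger0_norm // ger0_norm ?invr_ge0 // ler_pdivrMr //.
  apply: le_trans h2 _; rewrite -ler_pdivrMl // mulr1.
  apply: ltW; apply: lt_trans (archi_boundP _) _; first by rewrite invr_ge0 ltW.
  by rewrite ltr_nat ltnS.
have lim : (e (s k) * f t0)%g @[k --> \oo] --> (e s0 * f t0)%g.
  apply: mulg_cvg; last exact: cvg_cst.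
  by apply: cvg_comp slim _; exact: ec.
have nU : \forall k \near \oo, U (e (s k) * f t0)%g.
  by apply: lim; apply: open_nbhs_nbhs.
apply: filterS nU => k Uk m; rewrite Tx.
exists (e (s k) * f t0)%g; split => //; rewrite xE; exists (s k) => //.
rewrite /w; congr (_ * _)%g.
by rewrite /s mulrC divfK // fD (param_int fD f1) mulg1.
Qed.

End ScalarCase.

Theorem corollary4p5 (R : realType) (G : topGroupType) (n : nat)
    (lieG : lie_group R G n) (connG : connected [set: G])
    (torG : exists (C : set G) (d : nat), (2 <= d)%N /\ central_torus R C d) :
  ~ exists T : top_aut G, acts_expansively_on_Subp R T.
Proof.
move=> [T].
have hG : hausdorff_space G by case: lieG.
have [C [d [d2 [CZ [D [i [torD ic iM iinj iC]]]]]]] := torG.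
have [e [f [ep fp e1 f1 ind]]] := torus_circles torD d2.
have i1 : i 1%g = 1%g by apply: (@mulgI _ (i 1%g)); rewrite -iM !mulg1.
have cp (g : R -> D) : one_param g -> central_param (i \o g).
  move=> [gc gD]; split; first split.
  - by move=> t; apply: continuous_comp; [exact: gc|exact: ic].
  - by move=> s t /=; rewrite gD iM.
  - by move=> t; apply: CZ; rewrite -iC; exists (g t).
have [[w [wp [w1 windep]]]|H] := pselect (exists w : R -> G,
    central_param w /\ (w 1 = 1%g /\ independent w (T \o w))).
  exact: (cyclic_not_expansive lieG wp w1 windep).
apply: (scalar_not_expansive hG (cp e ep) (cp f fp)).
- by rewrite /= e1.
- by rewrite /= f1.
- move=> s t st; apply: ind => u; apply: iinj.
  by rewrite iM i1; exact: st.
by move=> w wp w1 windep; apply: H; exists w.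
Qed.
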